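(* Let $i\in\mathbb{N}_0$ and let $\alpha,\beta,\epsilon\in\mathbb{C}$. Then $$F^{1:1;2}_{1:0;1}\left[\begin{matrix}\alpha: & \epsilon\,; & \beta-\epsilon,\ 1-\alpha-\epsilon+i\,;\\ \beta: & -\,; & 1-\alpha-\epsilon+\beta+i\,;\end{matrix}\ \tfrac12,\ \tfrac12\right] =\frac{2^{i-\alpha}\,\Gamma(\beta-\epsilon-\alpha+i+1)\,\Gamma(\alpha-i)}{\Gamma(1-2\alpha-\epsilon+\beta+i)\,\Gamma(\alpha)}\sum_{r=0}^{i}(-1)^r\binom{i}{r}\frac{\Gamma\!\left(\frac{1-2\alpha-\epsilon+\beta+i+r}{2}\right)}{\Gamma\!\left(\frac{\beta-\epsilon-i+r+1}{2}\right)}$$ and $$F^{1:1;2}_{1:0;1}\left[\begin{matrix}\alpha: & \epsilon\,; & \beta-\epsilon,\ 1-\alpha-\epsilon-i\,;\\ \beta: & -\,; & 1-\alpha-\epsilon+\beta-i\,;\end{matrix}\ \tfrac12,\ \tfrac12\right] =\frac{2^{-\alpha-i}\,\Gamma(\beta-\epsilon-\alpha-i+1)}{\Gamma(1-2\alpha-\epsilon+\beta-i)}\sum_{r=0}^{i}\binom{i}{r}\frac{\Gamma\!\left(\frac{1-2\alpha-\epsilon+\beta-i+r}{2}\right)}{\Gamma\!\left(\frac{\beta-\epsilon-i+r+1}{2}\right)}.$$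
   Context: For $\lambda\in\mathbb{C}$ and $n\in\mathbb{N}_0$, $(\lambda)_0=1$ and $(\lambda)_n=\lambda(\lambda+1)\cdots(\lambda+n-1)$; $\Gamma$ is Euler's Gamma function and $\binom{i}{r}$ the binomial coefficient. The (generalized) Kampé de Fériet function is defined by $$F^{H:A;B}_{G:C;D}\left[\begin{matrix}(h_H): & (a_A)\,; & (b_B)\,;\\ (g_G): & (c_C)\,; & (d_D)\,;\end{matrix}\ x,\ y\right]=\sum_{m=0}^\infty\sum_{n=0}^\infty\frac{\prod_{j=1}^H(h_j)_{m+n}\prod_{j=1}^A(a_j)_m\prod_{j=1}^B(b_j)_n}{\prod_{j=1}^G(g_j)_{m+n}\prod_{j=1}^C(c_j)_m\prod_{j=1}^D(d_j)_n}\frac{x^m}{m!}\frac{y^n}{n!},$$ where a dash ''$-$'' denotes an empty list of parameters (empty products equal $1$). Parameters are tacitly assumed to be such that the double series converges, no denominator parameter is a non-positive integer, and all Gamma values appearing are finite. *)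

(* Defs.v *)
From Stdlib Require Import Reals List Arith Factorial.
From Coquelicot Require Import Coquelicot.
Open Scope C_scope.

Definition Clim_seq (u : nat -> C) : C :=
  (real (Lim_seq (fun n => fst (u n))), real (Lim_seq (fun n => snd (u n)))).

Definition Cis_lim_seq (u : nat -> C) (l : C) : Prop :=
  is_lim_seq (fun n => fst (u n)) (fst l) /\ is_lim_seq (fun n => snd (u n)) (snd l).

(* a^z = exp(z ln a) for real a > 0, with exp(x+iy) = e^x (cos y + i sin y). *)
Definition Crpow (a : R) (z : C) : C :=
  (exp (Re z * ln a) * cos (Im z * ln a),
   exp (Re z * ln a) * sin (Im z * ln a))%R.

Fixpoint Cnpow (z : C) (n : nat) : C :=
  match n with O => 1 | S k => z * Cnpow z k end.

Fixpoint poch (l : C) (n : nat) : C :=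
  match n with O => 1 | S k => poch l k * (l + RtoC (INR k)) end.

Definition gauss_seq (z : C) (n : nat) : C :=
  RtoC (INR (fact n)) * Crpow (INR n) z / poch z (S n).

(* Euler's Gamma function on C (Gauss' limit formula); meaningful (finite)
   exactly when z is not a non-positive integer. *)
Definition CGamma (z : C) : C := Clim_seq (gauss_seq z).

Definition gamma_finite (z : C) : Prop := forall k : nat, z <> RtoC (- INR k).

Definition prod_poch (ps : list C) (n : nat) : C :=
  fold_right (fun p acc => poch p n * acc) 1 ps.

Definition kdf_term (h g a c b d : list C) (x y : C) (m n : nat) : C :=
  prod_poch h (m + n) * prod_poch a m * prod_poch b n
  / (prod_poch g (m + n) * prod_poch c m * prod_poch d n)
  * (Cnpow x m / RtoC (INR (fact m))) * (Cnpow y n / RtoC (INR (fact n))).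

Definition kdf_partial (h g a c b d : list C) (x y : C) (N : nat) : C :=
  sum_n (fun m => sum_n (fun n => kdf_term h g a c b d x y m n) N) N.

Definition kdf_abs_conv (h g a c b d : list C) (x y : C) : Prop :=
  exists M : R, forall N : nat,
    (sum_n (fun m => sum_n (fun n => Cmod (kdf_term h g a c b d x y m n)) N) N <= M)%R.

(* F^{H:A;B}_{G:C;D}[(h):(a);(b);(g):(c);(d); x, y] *)
Definition KdF (h g a c b d : list C) (x y : C) : C :=
  Clim_seq (kdf_partial h g a c b d x y).

Definition nonpos_int_free (ps : list C) : Prop := List.Forall gamma_finite ps.

Definition Csign (r : nat) : C := Cnpow (RtoC (-1)) r.
Definition Cbinom (i r : nat) : C := RtoC (Binomial.C i r).

(* Main.v *)
Require Import Defs.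
From Stdlib Require Import Reals List Factorial Lra Lia.
From Coquelicot Require Import Coquelicot.
Import ListNotations.
Open Scope C_scope.

(** Along the diagonals [m + n = N] the inner sum of the double series is Saalschuetzian, so
    the Kampe de Feriet function collapses to the Gauss series [2F1(alpha, 1 - alpha +- i; d; 1/2)]
    with [d = 1 - alpha - eps + beta +- i].  Both [1 / Gamma] and the regularised series
    [2F1 / Gamma(d)] make sense for every [d], so shifts of [d] meet no exceptional values.

    At [x = 1/2] and [a + b = 1] the middle term of Gauss' contiguous relation in [c] drops out.
    Iterating the remaining recurrence [c -> c + 2] to infinity, where [2F1] tends to 1, turns
    it into Bailey's theorem (the case [i = 0]) by Gauss' limit formula.  Two further contiguous
    relations have the same binomial shape; iterated [i] times they expand the case of general
    [i] over Bailey values whose third parameters differ by [r], which gives the sum over [r]. *)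

Local Notation "# n" := (RtoC (INR n)) (at level 8, format "# n").
Local Notation "u --> l" := (filterlim u eventually (locally (l : C))) (at level 70).

(* Coquelicot states the results of its hierarchy in terms of the generic operations, which
   [ring] and [field] do not identify with those of [C]. *)
Ltac to_C :=
  repeat match goal with
  | |- context [@plus ?G ?x ?y] => change (@plus G x y) with (Cplus x y)
  | |- context [@minus ?G ?x ?y] => change (@minus G x y) with (Cminus x y)
  | |- context [@opp ?G ?x] => change (@opp G x) with (Copp x)
  | |- context [@zero ?G] => change (@zero G) with (RtoC 0)
  | |- context [@mult ?K ?x ?y] => change (@mult K x y) with (Cmult x y)
  | |- context [@scal ?K ?V ?x ?y] => change (@scal K V x y) with (Cmult x y)
  | |- context [@sum_n ?G] => progress change (@sum_n G) with (@sum_n C_AbelianMonoid)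
  end;
  match goal with |- @eq _ ?x ?y => change (@eq C x y) | _ => idtac end.
Ltac Cring := to_C; unfold Cdiv; ring.
Ltac Cfield := to_C; field.

Lemma RtoC_S (n : nat) : #(S n) = #n + 1.
Proof. now rewrite S_INR, RtoC_plus. Qed.

Lemma RtoC_S_neq_0 (n : nat) : #(S n) <> 0.
Proof. intros H; apply RtoC_inj in H; now apply (not_0_INR (S n)). Qed.

Lemma RtoC_fact_S (n : nat) : #(fact (S n)) = #(S n) * #(fact n).
Proof. rewrite fact_simpl, mult_INR; apply RtoC_mult. Qed.

Lemma RtoC_fact_neq_0 (n : nat) : #(fact n) <> 0.
Proof. intros H; apply RtoC_inj in H; now apply (INR_fact_neq_0 n). Qed.

(** * Limits and series *)

Lemma filterlim_C_unique (u : nat -> C) (l m : C) : u --> l -> u --> m -> l = m.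
Proof.
  exact (filterlim_locally_unique (F := eventually) (V := C_NormedModule) u l m).
Qed.

Lemma filterlim_Cplus (u v : nat -> C) (l m : C) :
  u --> l -> v --> m -> (fun n => u n + v n) --> (l + m).
Proof.
  intros Hu Hv; exact (filterlim_comp_2 _ _ _ Hu Hv (filterlim_plus (V := C_NormedModule) l m)).
Qed.

Lemma filterlim_Cmult (u v : nat -> C) (l m : C) :
  u --> l -> v --> m -> (fun n => u n * v n) --> (l * m).
Proof.
  intros Hu Hv P HP.
  refine (filterlim_comp_2 _ _ _ _ _ (filterlim_mult l m) P _).
  - intros Q HQ; now apply Hu, locally_C.
  - intros Q HQ; now apply Hv, locally_C.
  - now apply locally_C.
Qed.

Lemma filterlim_Cscal (a : C) (u : nat -> C) (l : C) : u --> l -> (fun n => a * u n) --> (a * l).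
Proof. intros Hu; apply filterlim_Cmult; [apply filterlim_const | exact Hu]. Qed.

Lemma filterlim_C_components {T : Type} (F : (T -> Prop) -> Prop) {FF : Filter F}
  (f : T -> C) (l : C) :
  filterlim f F (locally l) <->
  filterlim (fun t => fst (f t)) F (locally (fst l))
  /\ filterlim (fun t => snd (f t)) F (locally (snd l)).
Proof.
  split.
  - destruct l as [x y]; intros H; split; apply filterlim_comp with (1 := H).
    + apply continuous_fst.
    + apply continuous_snd.
  - intros [Hfst Hsnd]; apply filterlim_locally; intros eps.
    apply (filter_and _ _ (proj1 (filterlim_locally _ _) Hfst eps)
                          (proj1 (filterlim_locally _ _) Hsnd eps)).
Qed.

Lemma continuous_Cinv (z : C) : z <> 0 -> continuous Cinv z.
Proof.
  intros Hz.
  assert (Hnorm : (fst z ^ 2 + snd z ^ 2 <> 0)%R).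
  { change (Re z ^ 2 + Im z ^ 2 <> 0)%R; rewrite <- Cmod2_alt.
    apply pow_nonzero; now apply Rgt_not_eq, Cmod_gt_0. }
  assert (Hid : continuous (fun w : C => w) z) by apply continuous_id.
  apply filterlim_C_components in Hid as [Hfst Hsnd]; [|apply locally_filter].
  assert (Hsqr : forall h : C -> R, continuous h z -> continuous (fun w => (h w ^ 2)%R) z).
  { intros h Hh; apply (continuous_mult (K := R_AbsRing)); [exact Hh|].
    apply (continuous_mult (K := R_AbsRing)); [exact Hh | apply continuous_const]. }
  assert (Hden : continuous (fun w : C => (/ (fst w ^ 2 + snd w ^ 2))%R) z).
  { apply (continuous_comp (fun w : C => (fst w ^ 2 + snd w ^ 2)%R) Rinv);
      [|now apply continuous_Rinv].
    apply (continuous_plus (V := R_NormedModule)); now apply Hsqr. }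
  apply filterlim_C_components; [apply locally_filter|]; split.
  - exact (continuous_mult (K := R_AbsRing) _ _ _ Hfst Hden).
  - exact (continuous_mult (K := R_AbsRing) _ _ _ (continuous_opp _ _ Hsnd) Hden).
Qed.

Lemma filterlim_Cinv (u : nat -> C) (l : C) : l <> 0 -> u --> l -> (fun n => / u n) --> (/ l).
Proof. intros Hl Hu; exact (filterlim_comp _ _ _ _ _ _ _ _ Hu (continuous_Cinv l Hl)). Qed.

Lemma Clim_seq_correct (u : nat -> C) (l : C) : u --> l -> Clim_seq u = l.
Proof.
  intros H; apply filterlim_C_components in H as [Hfst Hsnd]; [|apply eventually_filter].
  unfold Clim_seq.
  rewrite (is_lim_seq_unique _ (fst l) Hfst), (is_lim_seq_unique _ (snd l) Hsnd).
  now destruct l.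
Qed.

Lemma filterlim_subseq {T : Type} (F : (T -> Prop) -> Prop) (u : nat -> T) (phi : nat -> nat) :
  filterlim phi eventually eventually ->
  filterlim u eventually F -> filterlim (fun n => u (phi n)) eventually F.
Proof. apply filterlim_comp. Qed.

Lemma filterlim_eventually_S : filterlim S eventually eventually.
Proof. apply eventually_subseq; intros n; lia. Qed.

Lemma filterlim_eventually_double : filterlim (fun n => 2 * n)%nat eventually eventually.
Proof. apply eventually_subseq; intros n; lia. Qed.

Lemma filterlim_eventually_decr_1 {T : Type} (F : (T -> Prop) -> Prop) (u : nat -> T) :
  filterlim (fun n => u (S n)) eventually F -> filterlim u eventually F.
Proof.
  intros H P HP; destruct (H P HP) as [N HN]; exists (S N); intros [|n] Hn; [lia|].
  apply HN; lia.
Qed.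

Lemma sum_n_telescope {G : AbelianGroup} (g : nat -> G) (n : nat) :
  sum_n (fun k => minus (g (S k)) (g k)) n = minus (g (S n)) (g 0%nat).
Proof.
  induction n as [|n IH]; [now rewrite sum_O|].
  rewrite sum_Sn, IH, plus_comm; symmetry; apply minus_trans.
Qed.

Section NormedSeries.
Context {K : AbsRing} {V : NormedModule K}.

Lemma is_series_telescope (g : nat -> V) (l : V) :
  filterlim g eventually (locally l) ->
  is_series (fun n => minus (g (S n)) (g n)) (minus l (g 0%nat)).
Proof.
  intros H; apply filterlim_ext with (fun n => minus (g (S n)) (g 0%nat)).
  - intros n; symmetry; apply (sum_n_telescope (G := V)).
  - refine (filterlim_comp_2 _ _ plus _ (filterlim_const (opp (g 0%nat)))
              (filterlim_plus l (opp (g 0%nat)))).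
    exact (filterlim_subseq _ _ _ filterlim_eventually_S H).
Qed.

Lemma is_lim_seq_norm (a : nat -> V) (l : V) :
  filterlim a eventually (locally l) -> is_lim_seq (fun n => norm (a n)) (norm l).
Proof. intros Ha; exact (filterlim_comp _ _ _ _ _ _ _ _ Ha (filterlim_norm l)). Qed.

Lemma norm_is_series_le (a : nat -> V) (b : nat -> R) (l : V) :
  is_series a l -> (forall n, (norm (a n) <= b n)%R) -> ex_series b ->
  (norm l <= Series b)%R.
Proof.
  intros Ha Hab Hb.
  refine (is_lim_seq_le _ _ (norm l) (Series b) _ (is_lim_seq_norm _ _ Ha) (Series_correct b Hb)).
  intros n; eapply Rle_trans; [apply norm_sum_n_m|].
  now apply sum_n_m_le.
Qed.

End NormedSeries.

Lemma sum_n_le_Series (a : nat -> R) (n : nat) :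
  (forall k, (0 <= a k)%R) -> ex_series a -> (sum_n a n <= Series a)%R.
Proof.
  intros Ha H; apply (is_lim_seq_incr_compare (sum_n a)); [exact (Series_correct a H)|].
  intros k; rewrite sum_Sn; unfold plus; simpl; generalize (Ha (S k)); lra.
Qed.

Lemma ex_series_Cmod (a : nat -> C) : ex_series (fun n => Cmod (a n)) -> ex_series a.
Proof.
  apply (ex_series_le (V := C_CompleteNormedModule)); intros n; apply Rle_refl.
Qed.

Lemma ex_series_eventually_le (a b : nat -> R) :
  (forall n, (0 <= a n)%R) -> eventually (fun n => (a n <= b n)%R) ->
  ex_series b -> ex_series a.
Proof.
  intros Ha [N HN] Hb; apply (ex_series_incr_n a N).
  apply (ex_series_le (V := R_CompleteNormedModule)) with (fun n => b (N + n)%nat).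
  - intros n; change (Rabs (a (N + n)%nat) <= b (N + n)%nat)%R.
    rewrite Rabs_pos_eq by apply Ha; apply HN; lia.
  - now apply (ex_series_incr_n b N).
Qed.

Lemma ex_series_ratio (t : nat -> R) (q : R) :
  (0 <= q < 1)%R -> (forall n, (0 <= t n)%R) ->
  eventually (fun n => (t (S n) <= q * t n)%R) -> ex_series t.
Proof.
  intros Hq Ht [N HN]; apply (ex_series_incr_n t N).
  apply ex_series_eventually_le with (fun n => (t N * q ^ n)%R); [intros; apply Ht| |].
  - exists 0%nat; intros n _; induction n as [|n IH]; [rewrite Nat.add_0_r; simpl; lra|].
    rewrite Nat.add_succ_r.
    eapply Rle_trans; [apply HN; lia|]; simpl.
    rewrite <- Rmult_assoc, (Rmult_comm (t N)), Rmult_assoc.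
    now apply Rmult_le_compat_l.
  - apply (ex_series_scal (V := R_NormedModule) (t N)), ex_series_geom.
    now rewrite Rabs_pos_eq.
Qed.

(* Unlike [ex_series_DAlembert], this allows terms that vanish. *)
Lemma ex_series_Cmod_ratio (t r : nat -> C) (x : C) :
  (Cmod x < 1)%R -> r --> x -> eventually (fun n => t (S n) = r n * t n) ->
  ex_series (fun n => Cmod (t n)).
Proof.
  intros Hx Hr Ht.
  assert (Hmod : is_lim_seq (fun n => Cmod (r n)) (Cmod x))
    by exact (is_lim_seq_norm (V := C_NormedModule) r x Hr).
  assert (Hx0 := Cmod_ge_0 x).
  apply ex_series_ratio with ((1 + Cmod x) / 2)%R; [lra | intros; apply Cmod_ge_0|].
  assert (Hev : eventually (fun n => (Cmod (r n) < (1 + Cmod x) / 2)%R)).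
  { apply (Hmod (fun y => (y < (1 + Cmod x) / 2)%R)), open_lt; lra. }
  generalize (filter_and _ _ Ht Hev); apply filter_imp; intros n [-> Hn].
  rewrite Cmod_mult; apply Rmult_le_compat_r; [apply Cmod_ge_0 | lra].
Qed.

Lemma exp_le_compat (x y : R) : (x <= y)%R -> (exp x <= exp y)%R.
Proof. intros [H| ->]; [left; now apply exp_increasing | apply Rle_refl]. Qed.

(** * Infinite products *)

Section InfiniteProduct.
Variables u e : nat -> C.
Hypothesis u_S : forall n, u (S n) = u n * (1 + e n).
Hypothesis e_summable : ex_series (fun n => Cmod (e n)).

Lemma Cmod_partial_prod_le (n : nat) :
  (Cmod (u (S n)) <= Cmod (u 0%nat) * exp (sum_n (fun k => Cmod (e k)) n))%R.
Proof.
  assert (Hstep : forall k, (Cmod (u (S k)) <= Cmod (u k) * exp (Cmod (e k)))%R).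
  { intros k; rewrite u_S, Cmod_mult.
    apply Rmult_le_compat_l; [apply Cmod_ge_0|].
    eapply Rle_trans; [apply Cmod_triangle|]; rewrite Cmod_1; apply exp_ineq1_le. }
  induction n as [|n IH]; [rewrite sum_O; apply Hstep|].
  rewrite sum_Sn; unfold plus; simpl; rewrite exp_plus, <- Rmult_assoc.
  eapply Rle_trans; [apply Hstep|].
  apply Rmult_le_compat_r; [left; apply exp_pos | exact IH].
Qed.

Lemma partial_prod_bounded : exists B : R, forall n, (Cmod (u n) <= B)%R.
Proof.
  set (S := Series (fun k => Cmod (e k))).
  exists (Rmax (Cmod (u 0%nat)) (Cmod (u 0%nat) * exp S)); intros [|n]; [apply Rmax_l|].
  eapply Rle_trans; [apply Cmod_partial_prod_le|]; eapply Rle_trans; [|apply Rmax_r].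
  apply Rmult_le_compat_l; [apply Cmod_ge_0|].
  apply exp_le_compat, sum_n_le_Series; [intros; apply Cmod_ge_0 | exact e_summable].
Qed.

Lemma partial_prod_converges : exists l : C, u --> l.
Proof.
  destruct partial_prod_bounded as [B HB].
  destruct (ex_series_Cmod (fun n => u n * e n)) as [l Hl].
  { apply ex_series_eventually_le with (fun n => (B * Cmod (e n))%R);
      [intros; apply Cmod_ge_0| |].
    - exists 0%nat; intros n _; rewrite Cmod_mult.
      apply Rmult_le_compat_r; [apply Cmod_ge_0 | apply HB].
    - exact (ex_series_scal (V := R_NormedModule) B _ e_summable). }
  exists (u 0%nat + l); apply filterlim_eventually_decr_1.
  apply filterlim_ext with (fun n => u 0%nat + sum_n (fun n => u n * e n) n).
  - intros n; induction n as [|n IH]; [rewrite sum_O, u_S; ring|].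
    rewrite sum_Sn, (u_S (S n)), <- IH; Cring.
  - apply filterlim_Cplus; [apply filterlim_const | exact Hl].
Qed.

End InfiniteProduct.

Lemma partial_prod_limit_neq_0 (u e : nat -> C) (l : C) :
  (forall n, u (S n) = u n * (1 + e n)) -> ex_series (fun n => Cmod (e n)) ->
  (forall n, u n <> 0) -> u --> l -> l <> 0.
Proof.
  intros Hu He Hnz Hl.
  assert (Hfactor : forall n, 1 + e n <> 0).
  { intros n H; apply (Hnz (S n)); rewrite Hu, H; ring. }
  (* The reciprocals are partial products too, so they converge as well. *)
  destruct (partial_prod_converges (fun n => / u n) (fun n => - e n / (1 + e n))) as [m Hm].
  { intros n; rewrite Hu; field; auto. }
  { assert (Hsmall : eventually (fun n => (Cmod (e n) < / 2)%R))
      by (apply (ex_series_lim_0 _ He (fun y => (y < / 2)%R)), open_lt; lra).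
    apply ex_series_eventually_le with (fun n => (2 * Cmod (e n))%R);
      [intros; apply Cmod_ge_0| |].
    - revert Hsmall; apply filter_imp; intros n Hn.
      rewrite Cmod_div, Cmod_opp by apply Hfactor.
      assert (Htri := Cmod_triangle (1 + e n) (- e n)).
      replace (1 + e n + - e n) with (RtoC 1) in Htri by ring.
      rewrite Cmod_1, Cmod_opp in Htri.
      apply Rle_div_l; [lra|]; generalize (Cmod_ge_0 (e n)); nra.
    - exact (ex_series_scal (V := R_NormedModule) 2%R _ He). }
  assert (Hlm : l * m = 1).
  { apply (filterlim_C_unique (fun n => u n * / u n)).
    - apply filterlim_Cmult; [exact Hl | exact Hm].
    - apply filterlim_ext with (fun _ => RtoC 1); [|apply filterlim_const].
      intros n; symmetry; now apply Cinv_r. }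
  intros ->; rewrite Cmult_0_l in Hlm; now apply C1_nz.
Qed.

(** * Complex exponentials and powers *)

Definition Cexp (z : C) : C := (exp (Re z) * cos (Im z), exp (Re z) * sin (Im z))%R.

Lemma Cexp_0 : Cexp 0 = 1.
Proof. unfold Cexp; simpl; rewrite exp_0, cos_0, sin_0; apply f_equal2; ring. Qed.

Lemma Cexp_plus (z w : C) : Cexp (z + w) = Cexp z * Cexp w.
Proof.
  unfold Cexp; rewrite re_plus, im_plus, exp_plus, cos_plus, sin_plus.
  apply injective_projections; simpl; ring.
Qed.

Lemma Cexp_RtoC (x : R) : Cexp x = RtoC (exp x).
Proof. unfold Cexp; simpl; rewrite cos_0, sin_0; apply f_equal2; ring. Qed.

Lemma Cmod_Cexp (z : C) : Cmod (Cexp z) = exp (Re z).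
Proof.
  unfold Cmod, Cexp; simpl.
  replace (_ + _)%R with (exp (Re z) ^ 2 * (Rsqr (sin (Im z)) + Rsqr (cos (Im z))))%R
    by (unfold Rsqr; ring).
  rewrite sin2_cos2, Rmult_1_r; apply sqrt_pow2; left; apply exp_pos.
Qed.

Lemma Cmod_bounded_variation (f f' : R -> C) (M a b : R) :
  (forall t, (Rabs (t - a) <= Rabs (b - a))%R ->
     is_derive (fun t => Re (f t)) t (Re (f' t)) /\ is_derive (fun t => Im (f t)) t (Im (f' t))
     /\ (Cmod (f' t) <= M)%R) ->
  (Cmod (f b - f a) <= M * Rabs (b - a))%R.
Proof.
  intros Hf.
  set (D := f b - f a).
  assert (HM : (0 <= M)%R).
  { eapply Rle_trans; [apply Cmod_ge_0|]; apply (Hf a).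
    rewrite Rminus_diag, Rabs_R0; apply Rabs_pos. }
  (* The real part of [conj D * f] has increment |D|^2 and derivative at most |D| M. *)
  assert (Hdot : forall z, Re (Cconj D * z) = (Re D * Re z + Im D * Im z)%R)
    by (intros z; rewrite re_mult, re_conj, im_conj; ring).
  assert (Hvar : (Rabs (Re (Cconj D * f b) - Re (Cconj D * f a))
                  <= Cmod D * M * Rabs (b - a))%R).
  { apply (bounded_variation (fun t => Re (Cconj D * f t)) (fun t => Re (Cconj D * f' t))).
    intros t Ht; destruct (Hf t Ht) as [Hre [Him HM']]; split.
    - apply is_derive_ext with (fun t => (Re D * Re (f t) + Im D * Im (f t))%R);
        [intros s; symmetry; apply Hdot|].
      rewrite Hdot; apply (is_derive_plus (V := R_NormedModule)); now apply is_derive_scal.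
    - eapply Rle_trans; [apply re_le_Cmod|]; rewrite Cmod_mult, Cmod_conj.
      now apply Rmult_le_compat_l; [apply Cmod_ge_0|]. }
  assert (Hsqr : (Re (Cconj D * f b) - Re (Cconj D * f a) = Cmod D ^ 2)%R)
    by (rewrite Cmod2_alt; unfold D; simpl; ring).
  rewrite Hsqr, Rabs_pos_eq in Hvar by apply pow2_ge_0.
  generalize (Cmod_ge_0 D) (Rmult_le_pos _ _ HM (Rabs_pos (b - a))); nra.
Qed.

Lemma Cmod_unit_increment_le (f f' : R -> C) (M : R) :
  (forall t, (Rabs t <= 1)%R ->
     is_derive (fun t => Re (f t)) t (Re (f' t)) /\ is_derive (fun t => Im (f t)) t (Im (f' t))
     /\ (Cmod (f' t) <= M)%R) ->
  (Cmod (f 1%R - f 0%R) <= M)%R.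
Proof.
  intros Hf; replace M with (M * Rabs (1 - 0))%R by (rewrite Rminus_0_r, Rabs_R1; ring).
  apply Cmod_bounded_variation with f'.
  intros t; rewrite !Rminus_0_r, Rabs_R1; apply Hf.
Qed.

Lemma Cexp_derive (z : C) (t : R) :
  is_derive (fun t => Re (Cexp (RtoC t * z))) t (Re (z * Cexp (RtoC t * z)))
  /\ is_derive (fun t => Im (Cexp (RtoC t * z))) t (Im (z * Cexp (RtoC t * z))).
Proof. split; unfold Cexp; simpl; auto_derive; trivial; unfold Rminus; ring. Qed.

Lemma Cmod_RtoC_mult_le (t : R) (z : C) : (Rabs t <= 1)%R -> (Cmod (RtoC t * z) <= Cmod z)%R.
Proof.
  intros Ht; rewrite Cmod_mult, Cmod_R; generalize (Cmod_ge_0 z); nra.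
Qed.

Lemma Cexp_sub_1_le (z : C) : (Cmod (Cexp z - 1) <= Cmod z * exp (Cmod z))%R.
Proof.
  replace (Cexp z - 1) with (Cexp (RtoC 1 * z) - Cexp (RtoC 0 * z))
    by (now rewrite Cmult_1_l, Cmult_0_l, Cexp_0).
  apply (Cmod_unit_increment_le (fun t => Cexp (RtoC t * z)) (fun t => z * Cexp (RtoC t * z))).
  intros t Ht; destruct (Cexp_derive z t) as [Hre Him]; split; [exact Hre | split; [exact Him|]].
  rewrite Cmod_mult, Cmod_Cexp.
  apply Rmult_le_compat_l; [apply Cmod_ge_0|]; apply exp_le_compat.
  eapply Rle_trans; [apply Rle_abs|]; eapply Rle_trans; [apply re_le_Cmod|].
  now apply Cmod_RtoC_mult_le.
Qed.

Lemma Cexp_sub_affine_le (z : C) :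
  (Cmod (Cexp z - 1 - z) <= Cmod z ^ 2 * exp (Cmod z))%R.
Proof.
  replace (Cexp z - 1 - z)
    with (Cexp (RtoC 1 * z) - RtoC 1 * z - (Cexp (RtoC 0 * z) - RtoC 0 * z))
    by (rewrite Cmult_1_l, Cmult_0_l, Cexp_0; ring).
  apply (Cmod_unit_increment_le (fun t => Cexp (RtoC t * z) - RtoC t * z)
           (fun t => z * (Cexp (RtoC t * z) - 1))).
  intros t Ht; split; [|split].
  1, 2: unfold Cexp; simpl; auto_derive; trivial; unfold Rminus; ring.
  rewrite Cmod_mult; replace (Cmod z ^ 2 * _)%R with (Cmod z * (Cmod z * exp (Cmod z)))%R by ring.
  apply Rmult_le_compat_l; [apply Cmod_ge_0|].
  assert (Hle := Cmod_RtoC_mult_le t z Ht).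
  eapply Rle_trans; [apply Cexp_sub_1_le|].
  apply Rmult_le_compat; trivial; [apply Cmod_ge_0 | left; apply exp_pos | now apply exp_le_compat].
Qed.

(* [1 + w u] is close to [exp (w u)], hence to [exp (w v)] when [u] is close to [v]. *)
Lemma Cmod_affine_mul_Cexp_sub_1_le (w : C) (u v : R) :
  (0 <= u <= v)%R -> (Cmod w * v <= 1)%R ->
  (Cmod ((1 + w * RtoC u) * Cexp (- (w * RtoC v)) - 1)
   <= Cmod w * (v - u) + 7 * Cmod w ^ 2 * v ^ 2)%R.
Proof.
  intros Huv Hwv.
  assert (Hw := Cmod_ge_0 w).
  set (rem := Cexp (- (w * RtoC v)) - 1 - - (w * RtoC v)).
  assert (Hrem : (Cmod rem <= 3 * (Cmod w * v) ^ 2)%R).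
  { unfold rem; eapply Rle_trans; [apply Cexp_sub_affine_le|].
    rewrite Cmod_opp, Cmod_mult, Cmod_R, (Rabs_pos_eq v) by lra.
    rewrite Rmult_comm; apply Rmult_le_compat_r; [apply pow2_ge_0|].
    eapply Rle_trans; [apply exp_le_compat, Hwv | apply exp_le_3]. }
  replace ((1 + w * RtoC u) * Cexp (- (w * RtoC v)) - 1)
    with (- (w * RtoC (v - u)) + - (w * w * RtoC (u * v)) + (1 + w * RtoC u) * rem)
    by (unfold rem; rewrite RtoC_minus, RtoC_mult; ring).
  assert (Hfactor : (Cmod (1 + w * RtoC u) <= 2)%R).
  { eapply Rle_trans; [apply Cmod_triangle|].
    rewrite Cmod_1, Cmod_mult, Cmod_R, Rabs_pos_eq by lra; nra. }
  eapply Rle_trans; [apply Cmod_triangle|].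
  eapply Rle_trans; [apply Rplus_le_compat_r, Cmod_triangle|].
  rewrite !Cmod_opp, !Cmod_mult, !Cmod_R, (Rabs_pos_eq (v - u)), (Rabs_pos_eq (u * v)) by nra.
  assert (Hlast : (Cmod (1 + w * RtoC u) * Cmod rem <= 2 * (3 * (Cmod w * v) ^ 2))%R)
    by (apply Rmult_le_compat; trivial; apply Cmod_ge_0).
  assert (Hmid : (Cmod w * Cmod w * (u * v) <= Cmod w * Cmod w * (v * v))%R)
    by (apply Rmult_le_compat_l; nra).
  lra.
Qed.

Lemma Crpow_Cexp (x : R) (z : C) : Crpow x z = Cexp (z * RtoC (ln x)).
Proof. unfold Crpow, Cexp; now rewrite re_scal_r, im_scal_r. Qed.

Lemma Crpow_plus (x : R) (z w : C) : Crpow x (z + w) = Crpow x z * Crpow x w.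
Proof. now rewrite !Crpow_Cexp, Cmult_plus_distr_r, Cexp_plus. Qed.

Lemma Crpow_mult (x y : R) (z : C) :
  (0 < x)%R -> (0 < y)%R -> Crpow (x * y) z = Crpow x z * Crpow y z.
Proof.
  intros Hx Hy.
  now rewrite !Crpow_Cexp, (ln_mult _ _ Hx Hy), RtoC_plus, Cmult_plus_distr_l, Cexp_plus.
Qed.

Lemma Crpow_0 (x : R) : Crpow x 0 = 1.
Proof. now rewrite Crpow_Cexp, Cmult_0_l, Cexp_0. Qed.

Lemma Crpow_1 (x : R) : (0 < x)%R -> Crpow x 1 = RtoC x.
Proof. intros Hx; now rewrite Crpow_Cexp, Cmult_1_l, Cexp_RtoC, exp_ln. Qed.

Lemma Crpow_INR (x : R) (n : nat) : (0 < x)%R -> Crpow x #n = RtoC x ^ n.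
Proof.
  intros Hx; induction n as [|n IH]; [apply Crpow_0|].
  rewrite RtoC_S, Crpow_plus, IH, Crpow_1 by exact Hx; simpl; ring.
Qed.

Lemma Crpow_neq_0 (x : R) (z : C) : Crpow x z <> 0.
Proof.
  intros H; apply C1_nz; rewrite <- (Crpow_0 x), <- (Cplus_opp_r z), Crpow_plus, H; ring.
Qed.

(** * The reciprocal Gamma function *)

(* Growth of [poch z n]; at [n >= 1] this is [(n - 1)! n^z]. *)
Definition gauss_scale (z : C) (n : nat) : C := #(fact n) * Crpow (INR n) (z - 1).

Definition rgauss (z : C) (n : nat) : C := poch z n / gauss_scale z n.

Definition rGamma (z : C) : C := Clim_seq (rgauss z).

Lemma gauss_scale_neq_0 (z : C) (n : nat) : gauss_scale z n <> 0.
Proof. apply Cmult_neq_0; [apply RtoC_fact_neq_0 | apply Crpow_neq_0]. Qed.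

Lemma gauss_scale_succ (z : C) (n : nat) :
  (1 <= n)%nat -> gauss_scale (z + 1) n = #n * gauss_scale z n.
Proof.
  intros Hn; unfold gauss_scale; replace (z + 1 - 1) with (z - 1 + 1) by ring.
  rewrite Crpow_plus, Crpow_1 by (apply lt_0_INR; lia); ring.
Qed.

Lemma INR_S_pos (n : nat) : (0 < INR (S n))%R.
Proof. apply lt_0_INR; lia. Qed.

Lemma ln_bounds (x : R) : (0 < x)%R -> (1 - / x <= ln x <= x - 1)%R.
Proof.
  assert (Hub : forall y, (0 < y)%R -> (ln y <= y - 1)%R).
  { intros y Hy; generalize (exp_ineq1_le (ln y)); rewrite exp_ln by exact Hy; lra. }
  intros Hx; split; [|now apply Hub].
  generalize (Hub (/ x)%R (Rinv_0_lt_compat _ Hx)); rewrite ln_Rinv by exact Hx; lra.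
Qed.

Definition ln_ratio (n : nat) : R := ln (INR (S (S n)) / INR (S n)).

Lemma ln_ratio_bounds (n : nat) : (/ INR (S (S n)) <= ln_ratio n <= / INR (S n))%R.
Proof.
  assert (Hs := INR_S_pos n); assert (Ht := INR_S_pos (S n)).
  unfold ln_ratio; destruct (ln_bounds _ (Rdiv_lt_0_compat _ _ Ht Hs)) as [Hlb Hub].
  rewrite (S_INR (S n)) in *; split.
  - replace (/ (INR (S n) + 1))%R with (1 - / ((INR (S n) + 1) / INR (S n)))%R
      by (field; lra); exact Hlb.
  - replace (/ INR (S n))%R with ((INR (S n) + 1) / INR (S n) - 1)%R by (field; lra); exact Hub.
Qed.

Definition rgauss_err (z : C) (n : nat) : C :=
  (1 + (z - 1) * RtoC (/ INR (S (S n)))) * Cexp (- ((z - 1) * RtoC (ln_ratio n))) - 1.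

Lemma rgauss_S (z : C) (n : nat) :
  rgauss z (S (S n)) = rgauss z (S n) * (1 + rgauss_err z n).
Proof.
  assert (Hs := INR_S_pos n); assert (Ht := INR_S_pos (S n)).
  assert (Hpow : Crpow (INR (S (S n))) (z - 1) * Cexp (- ((z - 1) * RtoC (ln_ratio n)))
                 = Crpow (INR (S n)) (z - 1)).
  { rewrite !Crpow_Cexp, <- Cexp_plus; f_equal; unfold ln_ratio.
    rewrite ln_div by assumption; rewrite RtoC_minus; ring. }
  unfold rgauss, gauss_scale, rgauss_err; rewrite <- Hpow.
  change (poch z (S (S n))) with (poch z (S n) * (z + #(S n))).
  replace (z + #(S n)) with (#(S (S n)) + (z - 1)) by (rewrite (RtoC_S (S n)); ring).
  rewrite (RtoC_fact_S (S n)), RtoC_inv by lra.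
  field; repeat split;
    first [apply RtoC_S_neq_0 | apply RtoC_fact_neq_0 | apply Crpow_neq_0 | idtac].
  intros H; apply (Crpow_neq_0 (INR (S n)) (z - 1)); rewrite <- Hpow, H; ring.
Qed.

Lemma ex_series_inv_sqr : ex_series (fun n => (/ INR (S n) ^ 2)%R).
Proof.
  set (g n := (- 2 * / INR (S n))%R).
  assert (Hg : filterlim g eventually (locally (- 2 * 0)%R)).
  { apply (is_lim_seq_mult' (fun _ => (-2)%R) (fun n => (/ INR (S n))%R) (-2) 0);
      [apply is_lim_seq_const|].
    apply (is_lim_seq_inv (fun n => INR (S n)) p_infty); [|discriminate].
    apply -> (is_lim_seq_incr_1 INR); apply is_lim_seq_INR. }
  apply ex_series_eventually_le with (fun n => (g (S n) - g n)%R).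
  - intros n; left; apply Rinv_0_lt_compat, pow_lt, INR_S_pos.
  - exists 0%nat; intros n _; unfold g; rewrite (S_INR (S n)).
    assert (Hn : (1 <= INR (S n))%R) by (rewrite S_INR; generalize (pos_INR n); lra).
    set (s := INR (S n)) in *.
    replace (-2 * / (s + 1) - -2 * / s)%R with (/ s ^ 2 * (2 * s / (s + 1)))%R by (field; lra).
    rewrite <- (Rmult_1_r (/ s ^ 2)) at 1.
    apply Rmult_le_compat_l; [left; apply Rinv_0_lt_compat, pow_lt; lra|].
    apply Rle_div_r; lra.
  - eexists; exact (is_series_telescope (V := R_NormedModule) g _ Hg).
Qed.

Lemma ex_series_rgauss_err (z : C) : ex_series (fun n => Cmod (rgauss_err z n)).
Proof.
  set (w := z - 1).
  apply ex_series_eventually_le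
    with (fun n => ((Cmod w + 7 * Cmod w ^ 2) * / INR (S n) ^ 2)%R);
    [intros; apply Cmod_ge_0| |exact (ex_series_scal (V := R_NormedModule) _ _ ex_series_inv_sqr)].
  destruct (INR_unbounded (Cmod w)) as [N HN]; exists N; intros n Hn.
  assert (Hs := INR_S_pos n); assert (Hw := Cmod_ge_0 w); apply le_INR in Hn.
  assert (Hbounds := ln_ratio_bounds n).
  unfold rgauss_err; fold w.
  set (u := (/ INR (S (S n)))%R) in *; set (v := ln_ratio n) in *.
  assert (Hu : (0 < u)%R) by apply Rinv_0_lt_compat, INR_S_pos.
  assert (Hvu : (v - u <= / INR (S n) ^ 2)%R).
  { apply Rle_trans with (/ INR (S n) - u)%R; [lra|].
    unfold u; rewrite (S_INR (S n)); set (s := INR (S n)) in *.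
    replace (/ s - / (s + 1))%R with (/ (s * (s + 1)))%R by (field; lra).
    apply Rinv_le_contravar; nra. }
  assert (Hv2 : (v ^ 2 <= / INR (S n) ^ 2)%R).
  { rewrite <- pow_inv; apply pow_incr; lra. }
  assert (Hwv : (Cmod w * v <= 1)%R).
  { rewrite <- (Rinv_r (INR (S n))) by lra.
    apply Rmult_le_compat; try lra; rewrite S_INR; lra. }
  eapply Rle_trans; [apply Cmod_affine_mul_Cexp_sub_1_le; lra|].
  rewrite Rmult_plus_distr_r.
  apply Rplus_le_compat; (apply Rmult_le_compat_l; [|assumption]); nra.
Qed.

Lemma rgauss_lim (z : C) : rgauss z --> rGamma z.
Proof.
  destruct (partial_prod_converges (fun n => rgauss z (S n)) (rgauss_err z)
              (rgauss_S z) (ex_series_rgauss_err z)) as [l Hl].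
  apply filterlim_eventually_decr_1 in Hl.
  unfold rGamma; now rewrite (Clim_seq_correct _ _ Hl).
Qed.

Lemma gamma_finite_plus_INR (z : C) (n : nat) : gamma_finite z -> z + #n <> 0.
Proof.
  intros Hz H; apply (Hz n); rewrite RtoC_opp.
  replace z with (z + #n - #n) by ring; rewrite H; ring.
Qed.

Lemma poch_neq_0 (z : C) (n : nat) : gamma_finite z -> poch z n <> 0.
Proof.
  intros Hz; induction n as [|n IH]; simpl; [apply C1_nz|].
  apply Cmult_neq_0; [exact IH | now apply gamma_finite_plus_INR].
Qed.

Lemma rgauss_neq_0 (z : C) (n : nat) : gamma_finite z -> rgauss z n <> 0.
Proof.
  intros Hz; apply Cmult_neq_0; [now apply poch_neq_0|].
  intros H; apply C1_nz; rewrite <- (Cinv_r _ (gauss_scale_neq_0 z n)), H; ring.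
Qed.

Lemma rGamma_neq_0 (z : C) : gamma_finite z -> rGamma z <> 0.
Proof.
  intros Hz.
  apply (partial_prod_limit_neq_0 (fun n => rgauss z (S n)) (rgauss_err z)).
  - apply rgauss_S.
  - apply ex_series_rgauss_err.
  - intros n; now apply rgauss_neq_0.
  - exact (filterlim_subseq _ _ _ filterlim_eventually_S (rgauss_lim z)).
Qed.

Lemma filterlim_inv_INR : (fun n => / #n) --> 0.
Proof.
  apply (filterlim_norm_zero (V := C_NormedModule)).
  apply (is_lim_seq_ext_loc (fun n => (/ INR n)%R) _ 0).
  - exists 1%nat; intros n Hn.
    assert (Hpos : (0 < INR n)%R) by (apply lt_0_INR; lia).
    change (/ INR n = Cmod (/ #n))%R.
    rewrite Cmod_inv, Cmod_R, Rabs_pos_eq; trivial; [lra|].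
    intros H; apply RtoC_inj in H; lra.
  - apply (is_lim_seq_inv INR p_infty); [apply is_lim_seq_INR | discriminate].
Qed.

Lemma eventually_plus_INR_neq_0 (z : C) : eventually (fun n => z + #n <> 0).
Proof.
  destruct (INR_unbounded (Cmod z)) as [N HN]; exists N; intros n Hn H; apply le_INR in Hn.
  assert (Hmod : Cmod #n = Cmod z) by (rewrite <- (Cmod_opp z); f_equal;
    rewrite <- (Cplus_0_l (- z)), <- H; ring).
  rewrite Cmod_R, Rabs_pos_eq in Hmod by apply pos_INR; lra.
Qed.

Lemma filterlim_shift_ratio (a b : C) : (fun n => (a + #n) / (b + #n)) --> 1.
Proof.
  assert (Haffine : forall z, (fun n => 1 + z * / #n) --> 1).
  { intros z.
    assert (H : (fun n => 1 + z * / #n) --> (1 + z * 0)).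
    { apply filterlim_Cplus; [apply filterlim_const|].
      apply filterlim_Cscal, filterlim_inv_INR. }
    now rewrite Cmult_0_r, Cplus_0_r in H. }
  replace (RtoC 1) with (1 * / 1) by field.
  apply filterlim_ext_loc with (fun n => (1 + a * / #n) * / (1 + b * / #n)).
  - generalize (filter_and _ _ (eventually_plus_INR_neq_0 0) (eventually_plus_INR_neq_0 b)).
    apply filter_imp; intros n [Hn Hb]; rewrite Cplus_0_l in Hn.
    field; repeat split; trivial; now rewrite Cplus_comm.
  - apply filterlim_Cmult; [apply Haffine|].
    apply filterlim_Cinv; [exact C1_nz | apply Haffine].
Qed.

Lemma CGamma_rGamma (z : C) : gamma_finite z -> CGamma z = / rGamma z.
Proof.
  intros Hz; apply Clim_seq_correct.
  rewrite <- (Cmult_1_r (/ rGamma z)).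
  apply filterlim_ext_loc with (fun n => / rgauss z n * ((0 + #n) / (z + #n))).
  - exists 1%nat; intros n Hn; unfold gauss_seq, rgauss.
    assert (Hpow : Crpow (INR n) z = Crpow (INR n) (z - 1) * #n).
    { rewrite <- (Crpow_1 (INR n)), <- Crpow_plus by (apply lt_0_INR; lia); f_equal; ring. }
    rewrite Hpow; unfold gauss_scale; simpl poch; field; repeat split.
    + now apply gamma_finite_plus_INR.
    + now apply poch_neq_0.
    + apply Crpow_neq_0.
    + apply RtoC_fact_neq_0.
  - apply filterlim_Cmult; [|apply filterlim_shift_ratio].
    apply filterlim_Cinv; [exact (rGamma_neq_0 z Hz) | apply rgauss_lim].
Qed.

Lemma CGamma_neq_0 (z : C) : gamma_finite z -> CGamma z <> 0.
Proof.
  intros Hz H; rewrite (CGamma_rGamma z Hz) in H.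
  apply C1_nz; rewrite <- (Cinv_r _ (rGamma_neq_0 z Hz)), H; ring.
Qed.

Lemma rGamma_CGamma (z : C) : gamma_finite z -> rGamma z = / CGamma z.
Proof.
  intros Hz; rewrite (CGamma_rGamma z Hz); field; now apply rGamma_neq_0.
Qed.

Lemma poch_S_l (z : C) (n : nat) : poch z (S n) = z * poch (z + 1) n.
Proof.
  induction n as [|n IH]; [simpl; ring|].
  change (poch z (S (S n))) with (poch z (S n) * (z + #(S n))).
  rewrite IH, RtoC_S; simpl; ring.
Qed.

Lemma rGamma_S (z : C) : rGamma z = z * rGamma (z + 1).
Proof.
  apply (filterlim_C_unique (fun n => z * rgauss (z + 1) n)).
  - rewrite <- (Cmult_1_r (rGamma z)).
    apply filterlim_ext_loc with (fun n => rgauss z n * ((z + #n) / (0 + #n))).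
    + exists 1%nat; intros n Hn; unfold rgauss; rewrite gauss_scale_succ by exact Hn.
      assert (Hn0 : #n <> 0) by (destruct n; [lia | apply RtoC_S_neq_0]).
      assert (Hscale := gauss_scale_neq_0 z n).
      transitivity (z * poch (z + 1) n / (#n * gauss_scale z n)); [|field; now split].
      rewrite <- poch_S_l; simpl poch; field; now split.
    + apply filterlim_Cmult; [apply rgauss_lim|].
      apply filterlim_shift_ratio.
  - apply filterlim_Cscal, rgauss_lim.
Qed.

Lemma rGamma_poch (z : C) (n : nat) : rGamma z = poch z n * rGamma (z + #n).
Proof.
  induction n as [|n IH]; simpl poch.
  - simpl INR; rewrite Cplus_0_r; ring.
  - rewrite IH, (rGamma_S (z + #n)), RtoC_S, Cplus_assoc; ring.
Qed.

Lemma CGamma_mul_rGamma_shift (z : C) (n : nat) :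
  gamma_finite z -> CGamma z * rGamma (z + #n) = / poch z n.
Proof.
  intros Hz; assert (Hp := poch_neq_0 z n Hz); assert (Hg := rGamma_neq_0 z Hz).
  rewrite (CGamma_rGamma z Hz); rewrite (rGamma_poch z n) in Hg |- *.
  field; split; [exact Hp|]; intros H; apply Hg; rewrite H; ring.
Qed.

Lemma poch_1 (n : nat) : poch 1 n = #(fact n).
Proof.
  induction n as [|n IH]; [reflexivity|].
  rewrite RtoC_fact_S, RtoC_S; simpl poch; rewrite IH; ring.
Qed.

Lemma rGamma_1 : rGamma 1 = 1.
Proof.
  apply Clim_seq_correct, filterlim_ext with (fun _ => RtoC 1); [|apply filterlim_const].
  intros n; unfold rgauss, gauss_scale; rewrite poch_1.
  replace (1 - 1) with (RtoC 0) by ring; rewrite Crpow_0; field; apply RtoC_fact_neq_0.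
Qed.

Lemma rGamma_1_plus_INR (n : nat) : rGamma (1 + #n) = / #(fact n).
Proof.
  assert (Hfact := RtoC_fact_neq_0 n); assert (H := rGamma_poch 1 n).
  rewrite rGamma_1, poch_1 in H.
  transitivity (/ #(fact n) * (#(fact n) * rGamma (1 + #n))); [field; exact Hfact|].
  rewrite <- H; ring.
Qed.

Lemma Cmod_poch_ge (c : C) (n : nat) :
  (1 <= Re c)%R -> (Re c * INR (fact (S n)) <= Cmod (poch c (S n)))%R.
Proof.
  intros Hc.
  assert (Hre : forall k, (Re c + INR k <= Cmod (c + #k))%R).
  { intros k; eapply Rle_trans; [|apply re_le_Cmod].
    rewrite re_plus; apply Rle_abs. }
  induction n as [|n IH].
  - generalize (Hre 0%nat); simpl; rewrite Cmult_1_l; lra.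
  - change (poch c (S (S n))) with (poch c (S n) * (c + #(S n))).
    rewrite Cmod_mult, fact_simpl, mult_INR, (Rmult_comm (INR (S (S n)))), <- Rmult_assoc.
    apply Rmult_le_compat; [|apply pos_INR|exact IH|].
    + apply Rmult_le_pos; [lra | apply pos_INR].
    + eapply Rle_trans; [|apply Hre]; rewrite (S_INR (S n)); lra.
Qed.

Lemma Cmod_rGamma_shift_le (c : C) (n : nat) :
  (1 <= Re c)%R ->
  (Cmod (rGamma (c + #(S n))) * Re c <= Cmod (rGamma c) * Cmod (rGamma (1 + #(S n))))%R.
Proof.
  intros Hc.
  assert (Hone : Cmod (rGamma (1 + #(S n))) = (/ INR (fact (S n)))%R).
  { rewrite rGamma_1_plus_INR, Cmod_inv by apply RtoC_fact_neq_0.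
    now rewrite Cmod_R, Rabs_pos_eq by apply pos_INR. }
  assert (Hfact := INR_fact_lt_0 (S n)).
  rewrite Hone; apply (Rle_div_r _ _ _ Hfact).
  rewrite (rGamma_poch c (S n)), Cmod_mult, (Rmult_comm (Cmod (poch _ _))), Rmult_assoc.
  apply Rmult_le_compat_l; [apply Cmod_ge_0 | now apply Cmod_poch_ge].
Qed.

Lemma gamma_finite_Re_pos (z : C) : (0 < Re z)%R -> gamma_finite z.
Proof.
  intros Hz n H; rewrite H in Hz; simpl in Hz; generalize (pos_INR n); lra.
Qed.

Lemma rGamma_shift_lim (z : C) : (fun n => rGamma (z + #n) * gauss_scale z n) --> 1.
Proof.
  destruct (INR_unbounded (- Re z)) as [N HN].
  assert (HzN : (0 < Re z + INR N)%R) by lra; clear HN; revert z HzN.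
  induction N as [|N IH]; intros z HzN.
  - assert (Hz : gamma_finite z) by (apply gamma_finite_Re_pos; simpl in HzN; lra).
    assert (Hnz := rGamma_neq_0 z Hz).
    rewrite <- (Cinv_r _ Hnz).
    apply filterlim_ext with (fun n => rGamma z * / rgauss z n).
    + intros n; rewrite (rGamma_poch z n); unfold rgauss.
      field; split; [apply gauss_scale_neq_0 | now apply poch_neq_0].
    + apply filterlim_Cscal, filterlim_Cinv; [exact Hnz | apply rgauss_lim].
  - rewrite <- (Cmult_1_l 1).
    apply filterlim_ext_loc
      with (fun n => (z + #n) / (0 + #n) * (rGamma (z + 1 + #n) * gauss_scale (z + 1) n)).
    + exists 1%nat; intros n Hn; rewrite gauss_scale_succ, (rGamma_S (z + #n)) by exact Hn.
      replace (z + 1 + #n) with (z + #n + 1) by ring.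
      field; destruct n; [lia | apply RtoC_S_neq_0].
    + apply filterlim_Cmult; [apply filterlim_shift_ratio|].
      apply IH; rewrite re_plus; rewrite S_INR in HzN; simpl; lra.
Qed.

(** * The regularised Gauss hypergeometric function *)

(* As [rGamma (c + n) = 1 / (Gamma(c) (c)_n)], the sum is [2F1(a, b; c; x) / Gamma(c)], but no
   [c] is excluded. *)
Definition rhyp_term (a b c x : C) (n : nat) : C :=
  poch a n * poch b n * rGamma (c + #n) * x ^ n / #(fact n).

Definition rhyp (a b c x : C) : C := Clim_seq (sum_n (rhyp_term a b c x)).

Section Hypergeometric.
Variable x : C.
Hypothesis Hx : (Cmod x < 1)%R.

Lemma ex_series_Cmod_rhyp_term (a b c : C) : ex_series (fun n => Cmod (rhyp_term a b c x n)).
Proof.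
  apply ex_series_Cmod_ratio
    with (fun n => (a + #n) / (1 + #n) * ((b + #n) / (c + #n)) * x) (1 * 1 * x);
    [now rewrite !Cmult_1_l| |].
  - apply filterlim_Cmult; [|apply filterlim_const].
    apply filterlim_Cmult; apply filterlim_shift_ratio.
  - generalize (eventually_plus_INR_neq_0 c); apply filter_imp; intros n Hcn.
    unfold rhyp_term; rewrite RtoC_fact_S, (rGamma_S (c + #n)), RtoC_S.
    replace (c + (#n + 1)) with (c + #n + 1) by ring; simpl.
    assert (Hn := RtoC_S_neq_0 n); rewrite RtoC_S in Hn.
    field; repeat split; trivial; [apply RtoC_fact_neq_0 | now rewrite Cplus_comm].
Qed.

Lemma rhyp_series (a b c : C) : is_series (rhyp_term a b c x) (rhyp a b c x).
Proof.
  destruct (ex_series_Cmod _ (ex_series_Cmod_rhyp_term a b c)) as [l Hl].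
  replace (rhyp a b c x) with l; [exact Hl|].
  symmetry; now apply Clim_seq_correct.
Qed.

Lemma rhyp_sym (a b c : C) : rhyp a b c x = rhyp b a c x.
Proof.
  apply Clim_seq_correct, (is_series_ext (V := C_NormedModule)) with (2 := rhyp_series b a c).
  intros n; unfold rhyp_term; Cring.
Qed.

Lemma rhyp_raise_a (a b c : C) :
  a * rhyp (a + 1) b (c + 1) x = rhyp a b c x - (c - a) * rhyp a b (c + 1) x.
Proof.
  assert (H : rhyp a b c x = a * rhyp (a + 1) b (c + 1) x + (c - a) * rhyp a b (c + 1) x).
  { apply Clim_seq_correct.
    apply (is_series_ext (V := C_NormedModule)) with (2 := is_series_plus _ _ _ _
      (is_series_scal a _ _ (rhyp_series (a + 1) b (c + 1)))
      (is_series_scal (c - a) _ _ (rhyp_series a b (c + 1)))).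
    intros n; to_C; unfold rhyp_term.
    replace (c + 1 + #n) with (c + #n + 1) by ring.
    rewrite (rGamma_S (c + #n)).
    transitivity ((a * poch (a + 1) n + (c - a) * poch a n) * poch b n * rGamma (c + #n + 1)
                  * x ^ n / #(fact n)); [Cring|].
    rewrite <- poch_S_l; simpl poch; Cring. }
  rewrite H; ring.
Qed.

Lemma rhyp_lower_b (a b c : C) :
  rhyp a (b - 1) c x = (1 - x) * rhyp a b c x + x * (c - a) * rhyp a b (c + 1) x.
Proof.
  set (s n := minus (rhyp_term a b c x n) (rhyp_term a (b - 1) c x n)).
  assert (Hs := is_series_minus _ _ _ _ (rhyp_series a b c) (rhyp_series a (b - 1) c)).
  assert (Hshift : is_series (fun n => s (S n))
                     (x * rhyp a b c x + - (x * (c - a)) * rhyp a b (c + 1) x)).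
  { apply (is_series_ext (V := C_NormedModule)) with (2 := is_series_plus _ _ _ _
      (is_series_scal x _ _ (rhyp_series a b c))
      (is_series_scal (- (x * (c - a))) _ _ (rhyp_series a b (c + 1)))).
    intros n; unfold s; to_C; unfold rhyp_term.
    rewrite (poch_S_l (b - 1)), RtoC_fact_S, (rGamma_S (c + #n)), RtoC_S.
    replace (b - 1 + 1) with b by ring.
    replace (c + 1 + #n) with (c + #n + 1) by ring.
    replace (c + (#n + 1)) with (c + #n + 1) by ring; simpl.
    assert (Hn := RtoC_S_neq_0 n); rewrite RtoC_S in Hn.
    field; split; [apply RtoC_fact_neq_0 | exact Hn]. }
  assert (Hsum : is_series s (x * rhyp a b c x + - (x * (c - a)) * rhyp a b (c + 1) x)).
  { apply is_series_decr_1.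
    replace (plus _ (opp (s 0%nat)))
      with (x * rhyp a b c x + - (x * (c - a)) * rhyp a b (c + 1) x); [exact Hshift|].
    unfold s, rhyp_term; simpl; Cring. }
  assert (Hdiff := filterlim_C_unique _ _ _ Hs Hsum).
  change (rhyp a b c x - rhyp a (b - 1) c x
          = x * rhyp a b c x + - (x * (c - a)) * rhyp a b (c + 1) x) in Hdiff.
  replace (rhyp a (b - 1) c x)
    with (rhyp a b c x - (rhyp a b c x - rhyp a (b - 1) c x)) by ring.
  rewrite Hdiff; ring.
Qed.

Lemma rhyp_contiguous_c (a b c : C) :
  (1 - x) * rhyp a b c x + ((2 * c - a - b + 1) * x - c) * rhyp a b (c + 1) x
  = x * (c - a + 1) * (c - b + 1) * rhyp a b (c + 2) x.
Proof.
  assert (Hlow : forall d, rhyp (a - 1) b d x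
                           = (1 - x) * rhyp a b d x + x * (d - b) * rhyp a b (d + 1) x)
    by (intros d; rewrite rhyp_sym, rhyp_lower_b, !(rhyp_sym b a); reflexivity).
  assert (Hraise := rhyp_raise_a (a - 1) b c).
  replace (a - 1 + 1) with a in Hraise by ring.
  rewrite !Hlow in Hraise; replace (c + 1 + 1) with (c + 2) in Hraise by ring.
  apply Ceq_minus.
  replace (_ - _) with ((1 - x) * rhyp a b c x + x * (c - b) * rhyp a b (c + 1) x
    - (c - (a - 1)) * ((1 - x) * rhyp a b (c + 1) x + x * (c + 1 - b) * rhyp a b (c + 2) x)
    - (a - 1) * rhyp a b (c + 1) x) by ring.
  rewrite Hraise; ring.
Qed.

(* Dominates the tail of the series at [c] by the one at [1]. *)
Lemma rhyp_sub_rGamma_le (a b : C) : exists K : R, forall c : C, (1 <= Re c)%R ->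
  (Cmod (rhyp a b c x - rGamma c) * Re c <= Cmod (rGamma c) * K)%R.
Proof.
  exists (Series (fun n => Cmod (rhyp_term a b 1 x (S n)))); intros c Hc.
  assert (Hsum : ex_series (fun n => Cmod (rhyp_term a b 1 x (S n))))
    by (apply (ex_series_incr_1 (fun n => Cmod (rhyp_term a b 1 x n)));
        apply ex_series_Cmod_rhyp_term).
  assert (Htail : is_series (fun n => rhyp_term a b c x (S n)) (rhyp a b c x - rGamma c)).
  { apply is_series_incr_1.
    replace (plus _ _) with (rhyp a b c x) by
      (unfold rhyp_term; simpl; rewrite Cplus_0_r; Cfield; apply C1_nz).
    apply rhyp_series. }
  apply Rle_div_r; [lra|].
  unfold Rdiv; rewrite Rmult_assoc, (Rmult_comm (Series _)), <- Rmult_assoc.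
  rewrite <- Series_scal_l.
  apply (norm_is_series_le (V := C_NormedModule) _ _ _ Htail);
    [|exact (ex_series_scal (V := R_NormedModule) _ _ Hsum)].
  intros n; change (norm (rhyp_term a b c x (S n))) with (Cmod (rhyp_term a b c x (S n))).
  set (T := poch a (S n) * poch b (S n) * x ^ S n / #(fact (S n))).
  assert (HT : forall d, rhyp_term a b d x (S n) = T * rGamma (d + #(S n)))
    by (intros d; unfold rhyp_term, T, Cdiv; ring).
  rewrite !HT, !Cmod_mult, (Rmult_comm (_ * / _)), Rmult_assoc.
  apply Rmult_le_compat_l; [apply Cmod_ge_0|].
  rewrite <- Rmult_assoc; apply Rle_div_r; [lra|].
  rewrite (Rmult_comm (Cmod (rGamma (1 + _)))); now apply Cmod_rGamma_shift_le.
Qed.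

Lemma rhyp_shift_lim (a b c : C) :
  (fun n => rhyp a b (c + #n) x * gauss_scale c n) --> 1.
Proof.
  destruct (rhyp_sub_rGamma_le a b) as [K HK].
  set (main n := rGamma (c + #n) * gauss_scale c n).
  set (rem n := (rhyp a b (c + #n) x - rGamma (c + #n)) * gauss_scale c n).
  apply filterlim_ext with (fun n => main n + rem n);
    [intros n; unfold main, rem; ring|].
  rewrite <- (Cplus_0_r 1); apply filterlim_Cplus; [apply rGamma_shift_lim|].
  apply (filterlim_norm_zero (V := C_NormedModule)).
  assert (Hbound : is_lim_seq (fun n => (Cmod (main n) * (K * / (Re c + INR n)))%R)
                     (Cmod 1 * (K * 0))%R).
  { apply is_lim_seq_mult'.
    - exact (is_lim_seq_norm (V := C_NormedModule) main (RtoC 1) (rGamma_shift_lim c)).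
    - apply is_lim_seq_mult'; [apply is_lim_seq_const|].
      apply (is_lim_seq_inv (fun n => Re c + INR n)%R p_infty); [|discriminate].
      apply (is_lim_seq_plus _ _ (Re c) p_infty);
        [apply is_lim_seq_const | apply is_lim_seq_INR | reflexivity]. }
  rewrite !Rmult_0_r in Hbound.
  refine (is_lim_seq_le_le_loc (fun _ => 0%R) _ _ 0 _ (is_lim_seq_const 0) Hbound).
  destruct (INR_unbounded (1 - Re c)) as [N HN]; exists N; intros n Hn.
  split; [apply Cmod_ge_0|].
  change (Cmod (rem n) <= Cmod (main n) * (K * / (Re c + INR n)))%R.
  apply le_INR in Hn; rewrite <- Rmult_assoc; apply Rle_div_r; [lra|].
  assert (Hn' : (1 <= Re (c + #n))%R) by (rewrite re_plus, re_RtoC; lra).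
  assert (H := HK _ Hn'); rewrite re_plus, re_RtoC in H.
  unfold rem, main; rewrite !Cmod_mult.
  generalize (Cmod_ge_0 (gauss_scale c n)); nra.
Qed.

End Hypergeometric.

(** * Bailey's theorem *)

Lemma RtoC_half : RtoC (/ 2) = / 2.
Proof. apply RtoC_inv; lra. Qed.

Lemma RtoC_2_neq_0 : RtoC 2 <> 0.
Proof. intros H; apply RtoC_inj in H; lra. Qed.

Lemma Cmod_half_lt_1 : (Cmod (RtoC (/ 2)) < 1)%R.
Proof. rewrite Cmod_R, Rabs_pos_eq; lra. Qed.

Lemma rhyp_half_shift2 (a c : C) :
  rhyp a (1 - a) c (RtoC (/ 2))
  = (c + 1 - a) * (c + a) * rhyp a (1 - a) (c + 2) (RtoC (/ 2)).
Proof.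
  assert (H := rhyp_contiguous_c _ Cmod_half_lt_1 a (1 - a) c).
  revert H; generalize (rhyp a (1 - a) c (RtoC (/ 2))) (rhyp a (1 - a) (c + 1) (RtoC (/ 2)))
    (rhyp a (1 - a) (c + 2) (RtoC (/ 2))); intros F0 F1 F2 H.
  rewrite RtoC_half in H.
  replace F0 with (2 * ((1 - / 2) * F0 + ((2 * c - a - (1 - a) + 1) * / 2 - c) * F1))
    by (field; apply RtoC_2_neq_0).
  rewrite H; field; apply RtoC_2_neq_0.
Qed.

Lemma rhyp_half_shift2_iter (a c : C) (n : nat) :
  rhyp a (1 - a) c (RtoC (/ 2)) * poch ((c - a) / 2) n
  = poch (c - a) (2 * n) * poch ((c + a) / 2) n * rhyp a (1 - a) (c + #(2 * n)) (RtoC (/ 2)).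
Proof.
  induction n as [|n IH].
  - simpl; rewrite Cplus_0_r; ring.
  - replace (2 * S n)%nat with (S (S (2 * n))) by lia.
    change (poch (c - a) (S (S (2 * n))))
      with (poch (c - a) (2 * n) * (c - a + #(2 * n)) * (c - a + #(S (2 * n)))).
    change (poch ((c - a) / 2) (S n)) with (poch ((c - a) / 2) n * ((c - a) / 2 + #n)).
    change (poch ((c + a) / 2) (S n)) with (poch ((c + a) / 2) n * ((c + a) / 2 + #n)).
    rewrite Cmult_assoc, IH, rhyp_half_shift2, !RtoC_S, mult_INR, RtoC_mult.
    change (INR 2) with 2%R.
    replace (c + (2 * #n + 1 + 1)) with (c + 2 * #n + 2) by ring.
    field; apply RtoC_2_neq_0.
Qed.

Lemma gauss_scale_double (a c : C) (n : nat) :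
  (1 <= n)%nat ->
  gauss_scale (c - a) (2 * n) * gauss_scale ((c + a) / 2) n
  = Crpow 2 (- a) * gauss_scale ((c - a) / 2) n * gauss_scale c (2 * n).
Proof.
  intros Hn; assert (Hpos : (0 < INR n)%R) by (apply lt_0_INR; lia).
  unfold gauss_scale; rewrite mult_INR; change (INR 2) with 2%R.
  rewrite !(Crpow_mult 2 (INR n)) by lra.
  replace (c - a - 1) with (- a + (c - 1)) by ring; rewrite (Crpow_plus 2).
  assert (Hexp : Crpow (INR n) (- a + (c - 1)) * Crpow (INR n) ((c + a) / 2 - 1)
                 = Crpow (INR n) ((c - a) / 2 - 1) * Crpow (INR n) (c - 1))
    by (rewrite <- !Crpow_plus; f_equal; field; apply RtoC_2_neq_0).
  transitivity (#(fact (2 * n)) * #(fact n) * Crpow 2 (- a) * Crpow 2 (c - 1)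
    * (Crpow (INR n) (- a + (c - 1)) * Crpow (INR n) ((c + a) / 2 - 1))); [ring|].
  rewrite Hexp; ring.
Qed.

Lemma bailey (a c : C) :
  rhyp a (1 - a) c (RtoC (/ 2)) * rGamma ((c - a) / 2)
  = Crpow 2 (- a) * rGamma (c - a) * rGamma ((c + a) / 2).
Proof.
  apply (filterlim_C_unique
    (fun _ : nat => rhyp a (1 - a) c (RtoC (/ 2)) * rGamma ((c - a) / 2)));
    [apply filterlim_const|].
  apply filterlim_ext_loc with (fun n => Crpow 2 (- a) * rgauss (c - a) (2 * n)
    * rgauss ((c + a) / 2) n * (rGamma ((c - a) / 2 + #n) * gauss_scale ((c - a) / 2) n)
    * (rhyp a (1 - a) (c + #(2 * n)) (RtoC (/ 2)) * gauss_scale c (2 * n))).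
  - exists 1%nat; intros n Hn.
    rewrite (rGamma_poch ((c - a) / 2) n), (Cmult_assoc (rhyp a (1 - a) c _)),
      rhyp_half_shift2_iter.
    assert (Hcancel : forall w s1 s2 s3 s4 p1 p2 g h : C,
      s1 <> 0 -> s2 <> 0 -> s1 * s2 = w * s3 * s4 ->
      w * (p1 / s1) * (p2 / s2) * (g * s3) * (h * s4) = p1 * p2 * h * g).
    { intros w s1 s2 s3 s4 p1 p2 g h Hs1 Hs2 Hs.
      transitivity (p1 * p2 * h * g * (w * s3 * s4) / (s1 * s2)); [field; now split|].
      rewrite <- Hs; field; now split. }
    apply Hcancel; [apply gauss_scale_neq_0 | apply gauss_scale_neq_0 |].
    now apply gauss_scale_double.
  - rewrite <- (Cmult_1_r (_ * rGamma ((c + a) / 2))), <- (Cmult_1_r (_ * 1)).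
    apply filterlim_Cmult; [apply filterlim_Cmult; [apply filterlim_Cmult|]|].
    + apply filterlim_Cscal.
      exact (filterlim_subseq _ _ _ filterlim_eventually_double (rgauss_lim (c - a))).
    + apply rgauss_lim.
    + apply rGamma_shift_lim.
    + exact (filterlim_subseq _ _ _ filterlim_eventually_double
               (rhyp_shift_lim _ Cmod_half_lt_1 a (1 - a) c)).
Qed.

Lemma poch_mul_rhyp_half (a c : C) (r : nat) :
  gamma_finite ((c - a + #r) / 2) -> gamma_finite ((c + a + #r) / 2) ->
  poch (c - a) r * rhyp a (1 - a) (c + #r) (RtoC (/ 2))
  = Crpow 2 (- a) * rGamma (c - a) * (CGamma ((c - a + #r) / 2) / CGamma ((c + a + #r) / 2)).
Proof.
  intros Hm Hp.
  assert (H := bailey a (c + #r)).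
  replace (c + #r - a) with (c - a + #r) in H by ring.
  replace (c + #r + a) with (c + a + #r) in H by ring.
  rewrite (CGamma_rGamma _ Hm), (CGamma_rGamma _ Hp), (rGamma_poch (c - a) r).
  assert (Hm' := rGamma_neq_0 _ Hm); assert (Hp' := rGamma_neq_0 _ Hp).
  transitivity (poch (c - a) r * (rhyp a (1 - a) (c + #r) (RtoC (/ 2))
                * rGamma ((c - a + #r) / 2)) / rGamma ((c - a + #r) / 2)); [field; exact Hm'|].
  rewrite H; field; now split.
Qed.

(** * Integer shifts of the parameters *)

Lemma sum_n_shift {G : AbelianMonoid} (a : nat -> G) (n : nat) :
  sum_n a (S n) = plus (a 0%nat) (sum_n (fun k => a (S k)) n).
Proof. unfold sum_n; now rewrite sum_Sn_m, sum_n_m_S by lia. Qed.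

Lemma Cbinom_0 (i : nat) : Cbinom i 0 = 1.
Proof. unfold Cbinom; now rewrite C_n_0. Qed.

Lemma Cbinom_diag (i : nat) : Cbinom i i = 1.
Proof. unfold Cbinom; now rewrite C_n_n. Qed.

Lemma Cbinom_pascal (i r : nat) :
  (r < i)%nat -> Cbinom (S i) (S r) = Cbinom i r + Cbinom i (S r).
Proof. intros H; unfold Cbinom; now rewrite <- RtoC_plus, pascal. Qed.

Lemma sum_Cbinom_S (x : nat -> C) (i : nat) :
  sum_n (fun r => Cbinom (S i) r * x r) (S i)
  = sum_n (fun r => Cbinom i r * (x r + x (S r))) i.
Proof.
  transitivity (sum_n (fun r => Cbinom i r * x r) i + sum_n (fun r => Cbinom i r * x (S r)) i).
  2: { etransitivity; [symmetry; apply (sum_n_plus (G := C_AbelianMonoid))|].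
       apply sum_n_ext; intros r; Cring. }
  destruct i as [|j].
  - rewrite sum_Sn, !sum_O, !Cbinom_0, Cbinom_diag; Cring.
  - rewrite sum_Sn, (sum_n_shift _ j), (sum_n_shift _ j), (sum_Sn (fun r => _ * x (S r)) j).
    rewrite !Cbinom_0, !Cbinom_diag.
    rewrite (sum_n_ext_loc (fun k => Cbinom (S (S j)) (S k) * x (S k))
      (fun k => plus (Cbinom (S j) k * x (S k)) (Cbinom (S j) (S k) * x (S k)))).
    + rewrite sum_n_plus; Cring.
    + intros r Hr; rewrite Cbinom_pascal by lia; Cring.
Qed.

Lemma poch_binomial_recurrence (F : nat -> C -> C) (p q a : C) :
  (forall i c, F (S i) c = p * F i c + q * (c - a) * F i (c + 1)) ->
  forall i c, F i c = sum_n (fun r => Cbinom i r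
                        * (p ^ (i - r) * q ^ r * (poch (c - a) r * F 0%nat (c + #r)))) i.
Proof.
  intros HF i; induction i as [|i IH]; intros c.
  - rewrite sum_O, Cbinom_0; simpl; rewrite Cplus_0_r; ring.
  - rewrite HF, (IH c), (IH (c + 1)), sum_Cbinom_S.
    etransitivity; [apply f_equal2; symmetry; apply (sum_n_mult_l (K := C_Ring))|].
    etransitivity; [symmetry; apply (sum_n_plus (G := C_AbelianMonoid))|].
    apply sum_n_ext_loc; intros r Hr; to_C.
    rewrite Nat.sub_succ, Nat.sub_succ_l, (poch_S_l (c - a)), RtoC_S by exact Hr.
    replace (c + 1 - a) with (c - a + 1) by ring.
    replace (c + (#r + 1)) with (c + 1 + #r) by ring.
    simpl; ring.
Qed.

Lemma rhyp_lower_b_iter (x a b c : C) (i : nat) :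
  (Cmod x < 1)%R ->
  rhyp a (b - #i) c x
  = sum_n (fun r => Cbinom i r
      * ((1 - x) ^ (i - r) * x ^ r * (poch (c - a) r * rhyp a b (c + #r) x))) i.
Proof.
  intros Hx.
  rewrite (poch_binomial_recurrence (fun i c => rhyp a (b - #i) c x) (1 - x) x a).
  - apply sum_n_ext; intros r; now replace (b - #0) with b by (simpl; ring).
  - intros j d; replace (b - #(S j)) with (b - #j - 1) by (rewrite RtoC_S; ring).
    now apply rhyp_lower_b.
Qed.

Lemma rhyp_raise_a_iter (x a b c : C) (i : nat) :
  (Cmod x < 1)%R ->
  poch a i * rhyp (a + #i) b (c + #i) x
  = sum_n (fun r => Cbinom i r * (Csign r * (poch (c - a) r * rhyp a b (c + #r) x))) i.
Proof.
  intros Hx.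
  rewrite (poch_binomial_recurrence (fun i c => poch a i * rhyp (a + #i) b (c + #i) x) 1 (-1) a).
  - apply sum_n_ext; intros r; change (Csign r) with ((-1) ^ r).
    rewrite Cpow_1_l; simpl poch.
    simpl INR; rewrite !Cplus_0_r; Cring.
  - intros j d; simpl poch.
    replace (a + #(S j)) with (a + #j + 1) by (rewrite RtoC_S; ring).
    replace (d + #(S j)) with (d + #j + 1) by (rewrite RtoC_S; ring).
    replace (d + 1 + #j) with (d + #j + 1) by ring.
    rewrite <- Cmult_assoc, (rhyp_raise_a _ Hx); ring.
Qed.

Lemma bailey_sub_nat (a c : C) (i : nat) :
  gamma_finite (c - a) ->
  (forall r, (r <= i)%nat ->
     gamma_finite ((c - a + #r) / 2) /\ gamma_finite ((c + a + #r) / 2)) ->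
  rhyp a (1 - a - #i) c (RtoC (/ 2))
  = Crpow 2 (- a - #i) / CGamma (c - a)
    * sum_n (fun r => Cbinom i r * CGamma ((c - a + #r) / 2) / CGamma ((c + a + #r) / 2)) i.
Proof.
  intros Hca Hfin; rewrite (rhyp_lower_b_iter _ _ _ _ _ Cmod_half_lt_1).
  etransitivity; [|apply (sum_n_mult_l (K := C_Ring))].
  apply sum_n_ext_loc; intros r Hr; destruct (Hfin r Hr) as [Hm Hp].
  rewrite (poch_mul_rhyp_half a c r Hm Hp), (rGamma_CGamma _ Hca).
  assert (Hpow : Crpow 2 (- a - #i) = (/ 2) ^ (i - r) * (/ 2) ^ r * Crpow 2 (- a)).
  { rewrite <- Cpow_add_r, Nat.sub_add, Cpow_inv by (trivial; apply RtoC_2_neq_0).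
    rewrite <- Crpow_INR by lra; replace (- a) with (- a - #i + #i) at 2 by ring.
    rewrite Crpow_plus; field; apply Crpow_neq_0. }
  rewrite Hpow, RtoC_half; to_C.
  replace (1 - / 2) with (/ 2) by (field; apply RtoC_2_neq_0).
  Cring.
Qed.

Lemma bailey_add_nat (a c : C) (i : nat) :
  gamma_finite (a - #i) -> gamma_finite a -> gamma_finite (c - a) ->
  (forall r, (r <= i)%nat ->
     gamma_finite ((c - a + #r) / 2) /\ gamma_finite ((c + a - 2 * #i + #r) / 2)) ->
  rhyp a (1 - a + #i) c (RtoC (/ 2))
  = Crpow 2 (#i - a) * CGamma (a - #i) / (CGamma (c - a) * CGamma a)
    * sum_n (fun r => Csign r * Cbinom i r * CGamma ((c - a + #r) / 2)
                      / CGamma ((c + a - 2 * #i + #r) / 2)) i.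
Proof.
  intros Hai Ha Hca Hfin.
  assert (Hiter := rhyp_raise_a_iter _ (a - #i) (1 - (a - #i)) (c - #i) i Cmod_half_lt_1).
  replace (a - #i + #i) with a in Hiter by ring.
  replace (c - #i + #i) with c in Hiter by ring.
  replace (1 - (a - #i)) with (1 - a + #i) in Hiter at 1 by ring.
  assert (Hpoch := CGamma_mul_rGamma_shift _ i Hai).
  replace (a - #i + #i) with a in Hpoch by ring.
  transitivity (/ poch (a - #i) i * (poch (a - #i) i * rhyp a (1 - a + #i) c (RtoC (/ 2))));
    [field; now apply poch_neq_0|].
  rewrite Hiter, <- Hpoch, (rGamma_CGamma _ Ha).
  etransitivity; [symmetry; apply (sum_n_mult_l (K := C_Ring))|].
  etransitivity; [|apply (sum_n_mult_l (K := C_Ring))].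
  apply sum_n_ext_loc; intros r Hr; destruct (Hfin r Hr) as [Hm Hp].
  replace (c - a) with (c - #i - (a - #i)) in * by ring.
  replace (c + a - 2 * #i) with (c - #i + (a - #i)) in * by ring.
  rewrite (poch_mul_rhyp_half (a - #i) (c - #i) r Hm Hp), (rGamma_CGamma _ Hca).
  replace (- (a - #i)) with (#i - a) by ring.
  Cfield; repeat split; now apply CGamma_neq_0.
Qed.

(** * The Pfaff-Saalschuetz sum *)

Definition saalschutz_term (a c e : C) (N n : nat) : C :=
  poch e (N - n) / #(fact (N - n))
  * (poch a n * poch c n / (poch (a + c + e) n * #(fact n))).

(* Zeilberger's recurrence in [N], with [- n (a + c + e + n - 1) t (N + 1) n] as certificate. *)
Lemma saalschutz_term_recurrence (a c e : C) (N n : nat) :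
  let cert n := - (#n * (a + c + e + #n - 1) * saalschutz_term a c e (S N) n) in
  gamma_finite (a + c + e) -> (n <= N)%nat ->
  #(S N) * (a + c + e + #N) * saalschutz_term a c e (S N) n
  = (c + e + #N) * (a + e + #N) * saalschutz_term a c e N n + (cert (S n) - cert n).
Proof.
  intros cert Hfin Hn; unfold cert, saalschutz_term.
  assert (Hp := poch_neq_0 _ n Hfin); assert (Hq := gamma_finite_plus_INR _ n Hfin).
  rewrite Nat.sub_succ, Nat.sub_succ_l by exact Hn.
  assert (HN : #N = #(N - n) + #n) by (rewrite <- RtoC_plus, <- plus_INR; do 2 f_equal; lia).
  rewrite (RtoC_S N), HN; set (m := (N - n)%nat).
  assert (Hm := RtoC_S_neq_0 m); assert (Hn' := RtoC_S_neq_0 n); rewrite RtoC_S in Hm, Hn'.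
  rewrite !RtoC_fact_S, !RtoC_S; simpl poch.
  field; repeat split; trivial; apply RtoC_fact_neq_0.
Qed.

Lemma saalschutz (a c e : C) (N : nat) :
  gamma_finite (a + c + e) ->
  sum_n (saalschutz_term a c e N) N
  = poch (c + e) N * poch (a + e) N / (poch (a + c + e) N * #(fact N)).
Proof.
  intros Hfin; induction N as [|N IH].
  - rewrite sum_O; unfold saalschutz_term; simpl; field; apply C1_nz.
  - assert (Hp := poch_neq_0 _ N Hfin); assert (Hq := gamma_finite_plus_INR _ N Hfin).
    assert (HS : #(S N) * (a + c + e + #N) * sum_n (saalschutz_term a c e (S N)) (S N)
                 = (c + e + #N) * (a + e + #N) * sum_n (saalschutz_term a c e N) N).
    { rewrite sum_Sn; to_C; rewrite Cmult_plus_distr_l.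
      rewrite <- (sum_n_mult_l (K := C_Ring)).
      erewrite (sum_n_ext_loc _ _ N)
        by (intros n Hn; exact (saalschutz_term_recurrence a c e N n Hfin Hn)).
      rewrite (sum_n_plus (G := C_AbelianMonoid)), (sum_n_mult_l (K := C_Ring)).
      rewrite (sum_n_telescope (G := C_AbelianGroup)
        (fun n => - (#n * (a + c + e + #n - 1) * saalschutz_term a c e (S N) n))).
      rewrite RtoC_S; simpl INR; Cring. }
    rewrite IH in HS.
    transitivity (#(S N) * (a + c + e + #N) * sum_n (saalschutz_term a c e (S N)) (S N)
                  / (#(S N) * (a + c + e + #N))).
    { symmetry; Cfield; split; [exact Hq | apply RtoC_S_neq_0]. }
    rewrite HS, RtoC_fact_S; simpl poch; Cfield.
    repeat split; trivial; [apply RtoC_fact_neq_0 | apply RtoC_S_neq_0].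
Qed.

(** * Summation of double series by squares and by diagonals *)

Definition square_sum {G : AbelianMonoid} (f : nat -> nat -> G) (N : nat) : G :=
  sum_n (fun m => sum_n (f m) N) N.

Definition triangle_sum {G : AbelianMonoid} (f : nat -> nat -> G) (N : nat) : G :=
  sum_n (fun m => sum_n (f m) (N - m)) N.

Lemma sum_n_diagonals {G : AbelianMonoid} (f : nat -> nat -> G) (N : nat) :
  sum_n (fun k => sum_n (fun m => f m (k - m)%nat) k) N = triangle_sum f N.
Proof.
  unfold triangle_sum; induction N as [|N IH]; [now rewrite !sum_O|].
  rewrite sum_Sn, IH, (sum_Sn (fun m => f m (S N - m)%nat)), plus_assoc, <- sum_n_plus.
  rewrite (sum_Sn (fun m => sum_n (f m) (S N - m))), Nat.sub_diag, sum_O.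
  f_equal; apply sum_n_ext_loc; intros m Hm.
  now rewrite Nat.sub_succ_l, sum_Sn by exact Hm.
Qed.

Lemma sum_n_incr (x : nat -> R) (k n : nat) :
  (forall i, (0 <= x i)%R) -> (k <= n)%nat -> (sum_n x k <= sum_n x n)%R.
Proof.
  intros Hx Hk; induction Hk as [|n Hk IH]; [apply Rle_refl|].
  rewrite sum_Sn; unfold plus; simpl; generalize (Hx (S n)); lra.
Qed.

Lemma sum_n_le_loc (x y : nat -> R) (n : nat) :
  (forall i, (i <= n)%nat -> (x i <= y i)%R) -> (sum_n x n <= sum_n y n)%R.
Proof.
  induction n as [|n IH]; intros H; [rewrite !sum_O; now apply H|].
  rewrite !sum_Sn; apply Rplus_le_compat; [apply IH; intros; apply H; lia | now apply H].
Qed.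

Lemma square_sum_le (f : nat -> nat -> R) (K : nat -> nat) (h N : nat) :
  (forall m n, (0 <= f m n)%R) -> (h <= N)%nat -> (forall m, (m <= h)%nat -> (h <= K m)%nat) ->
  (square_sum f h <= sum_n (fun m => sum_n (f m) (K m)) N)%R.
Proof.
  intros Hf HhN HK.
  assert (Hrow : forall m k, (0 <= sum_n (f m) k)%R).
  { intros m k; apply Rle_trans with (sum_n (f m) 0); [rewrite sum_O; apply Hf|].
    apply sum_n_incr; [apply Hf | lia]. }
  eapply Rle_trans; [|apply (sum_n_incr _ h); [intros; apply Hrow | exact HhN]].
  apply sum_n_le_loc; intros m Hm; apply sum_n_incr; [apply Hf | now apply HK].
Qed.

Lemma square_sum_div2_le_triangle_sum (f : nat -> nat -> R) (N : nat) :
  (forall m n, (0 <= f m n)%R) -> (square_sum f (N / 2) <= triangle_sum f N)%R.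
Proof.
  intros Hf; assert (Hdiv : (2 * (N / 2) <= N)%nat) by apply Nat.Div0.mul_div_le.
  apply square_sum_le; [exact Hf | lia | intros; lia].
Qed.

Lemma square_sum_tail_lim (f : nat -> nat -> R) (M : R) :
  (forall m n, (0 <= f m n)%R) -> (forall N, (square_sum f N <= M)%R) ->
  is_lim_seq (fun N => (square_sum f N - square_sum f (N / 2))%R) 0.
Proof.
  intros Hf HM.
  destruct (ex_finite_lim_seq_incr (square_sum f) M) as [L HL]; [|exact HM|].
  { intros N; apply (square_sum_le f (fun _ => S N)); [exact Hf | lia | intros; lia]. }
  assert (Hhalf : filterlim (fun N => N / 2)%nat eventually eventually).
  { intros P [N HN]; exists (2 * N)%nat; intros n Hn; apply HN.
    apply Nat.div_le_lower_bound; lia. }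
  rewrite <- (Rminus_diag L).
  exact (is_lim_seq_minus' _ _ _ _ HL (is_lim_seq_subseq _ _ _ Hhalf HL)).
Qed.

Section DoubleSeries.
Context {K : AbsRing} {V : NormedModule K}.

Lemma norm_sum_n_tail_le (a : nat -> V) (k n : nat) : (k <= n)%nat ->
  (norm (minus (sum_n a n) (sum_n a k))
   <= sum_n (fun i => norm (a i)) n - sum_n (fun i => norm (a i)) k)%R.
Proof.
  intros Hk; rewrite <- (sum_n_m_sum_n (G := V)) by exact Hk.
  eapply Rle_trans; [apply norm_sum_n_m|].
  right; exact (sum_n_m_sum_n (G := R_AbelianGroup) _ k n Hk).
Qed.

Lemma norm_sum_n_minus_le (x y : nat -> V) (p q : nat -> R) (n : nat) :
  (forall i, (i <= n)%nat -> (norm (minus (x i) (y i)) <= p i - q i)%R) ->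
  (norm (minus (sum_n x n) (sum_n y n)) <= sum_n p n - sum_n q n)%R.
Proof.
  induction n as [|n IH]; intros H; [rewrite !sum_O; now apply H|].
  rewrite !sum_Sn; change (@plus R_AbelianMonoid) with Rplus.
  replace (minus (plus (sum_n x n) (x (S n))) (plus (sum_n y n) (y (S n))))
    with (plus (minus (sum_n x n) (sum_n y n)) (minus (x (S n)) (y (S n)))).
  - eapply Rle_trans; [apply norm_triangle|].
    assert (Hn : (norm (minus (sum_n x n) (sum_n y n)) <= sum_n p n - sum_n q n)%R)
      by (apply IH; intros; apply H; lia).
    generalize (H (S n) (le_n _)); lra.
  - unfold minus; rewrite (opp_plus (G := V)), <- !(plus_assoc (G := V)); f_equal.
    rewrite !(plus_assoc (G := V)); f_equal; apply (plus_comm (G := V)).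
Qed.

Lemma norm_square_minus_triangle_le (f : nat -> nat -> V) (N : nat) :
  (norm (minus (square_sum f N) (triangle_sum f N))
   <= square_sum (fun m n => norm (f m n)) N - triangle_sum (fun m n => norm (f m n)) N)%R.
Proof. apply norm_sum_n_minus_le; intros m Hm; apply norm_sum_n_tail_le; lia. Qed.

Lemma square_sum_lim (f : nat -> nat -> V) (M : R) (l : V) :
  (forall N, (square_sum (fun m n => norm (f m n)) N <= M)%R) ->
  is_series (fun k => sum_n (fun m => f m (k - m)%nat) k) l ->
  filterlim (square_sum f) eventually (locally l).
Proof.
  intros HM Hl.
  set (F := square_sum (fun m n => norm (f m n))).
  assert (Hpos : forall m n, (0 <= norm (f m n))%R) by (intros; apply norm_ge_0).
  assert (Hdiff : filterlim (fun N => minus (square_sum f N) (triangle_sum f N))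
                    eventually (locally (zero : V))).
  { apply filterlim_norm_zero.
    refine (is_lim_seq_le_le (fun _ => 0%R) _ (fun N => F N - F (N / 2)%nat)%R 0 _
              (is_lim_seq_const 0) (square_sum_tail_lim _ M Hpos HM)).
    intros N; split; [apply norm_ge_0|].
    eapply Rle_trans; [apply norm_square_minus_triangle_le|].
    apply Rplus_le_compat_l, Ropp_le_contravar.
    now apply square_sum_div2_le_triangle_sum. }
  rewrite <- (plus_zero_l (G := V) l).
  apply filterlim_ext
    with (fun N => plus (minus (square_sum f N) (triangle_sum f N)) (triangle_sum f N)).
  - intros N; unfold minus.
    now rewrite <- (plus_assoc (G := V)), (plus_opp_l (G := V)), (plus_zero_r (G := V)).
  - refine (filterlim_comp_2 _ _ plus Hdiff _ (filterlim_plus (zero : V) l)).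
    apply filterlim_ext with (2 := Hl); intros N; apply sum_n_diagonals.
Qed.

End DoubleSeries.

(** * Reduction of the Kampe de Feriet function *)

Lemma kdf_diagonal (alpha beta eps c x : C) (N : nat) :
  gamma_finite beta -> gamma_finite (c + beta) ->
  sum_n (fun n => kdf_term [alpha] [beta] [eps] [] [beta - eps; c] [c + beta] x x (N - n) n) N
  = CGamma (c + beta) * rhyp_term alpha (c + eps) (c + beta) x N.
Proof.
  intros Hb Hd.
  assert (Hpb := poch_neq_0 _ N Hb).
  replace (c + beta) with (beta - eps + c + eps) in * by ring.
  transitivity (poch alpha N / poch beta N * x ^ N
                * sum_n (saalschutz_term (beta - eps) c eps N) N).
  - rewrite <- (sum_n_mult_l (K := C_Ring)); apply sum_n_ext_loc; intros n Hn.
    unfold kdf_term, saalschutz_term; simpl prod_poch; change Cnpow with Cpow.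
    replace (N - n + n)%nat with N by lia.
    replace (x ^ N) with (x ^ (N - n) * x ^ n) by (rewrite <- Cpow_add_r; f_equal; lia).
    assert (Hpn := poch_neq_0 _ n Hd); Cfield; repeat split; trivial; apply RtoC_fact_neq_0.
  - rewrite (saalschutz _ _ _ N Hd); unfold rhyp_term.
    replace (beta - eps + eps) with beta by ring.
    assert (Hpd := poch_neq_0 _ N Hd); assert (Hshift := CGamma_mul_rGamma_shift _ N Hd).
    transitivity (poch alpha N * poch (c + eps) N * x ^ N / #(fact N)
                  * (/ poch (beta - eps + c + eps) N)).
    + Cfield; repeat split; trivial; apply RtoC_fact_neq_0.
    + rewrite <- Hshift; Cring.
Qed.

Lemma KdF_eq_rhyp (alpha beta eps c x : C) :
  (Cmod x < 1)%R -> nonpos_int_free [beta; c + beta] ->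
  kdf_abs_conv [alpha] [beta] [eps] [] [beta - eps; c] [c + beta] x x ->
  KdF [alpha] [beta] [eps] [] [beta - eps; c] [c + beta] x x
  = CGamma (c + beta) * rhyp alpha (c + eps) (c + beta) x.
Proof.
  intros Hx Hfree [M HM].
  assert (Hb := Forall_inv Hfree); assert (Hd := Forall_inv (Forall_inv_tail Hfree)).
  set (f m n := kdf_term [alpha] [beta] [eps] [] [beta - eps; c] [c + beta] x x m n).
  apply Clim_seq_correct.
  apply filterlim_ext with (square_sum (fun n m => f m n));
    [intros N; apply (sum_n_switch (fun n m => f m n))|].
  apply (square_sum_lim (V := C_NormedModule)) with M.
  - intros N; eapply Rle_trans; [|apply (HM N)].
    right; apply (sum_n_switch (fun n m => Cmod (f m n))).
  - apply (is_series_ext (V := C_NormedModule)) with (2 := is_series_scal (V := C_NormedModule)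
      (CGamma (c + beta)) _ _ (rhyp_series x Hx alpha (c + eps) (c + beta))).
    intros N; symmetry; now apply kdf_diagonal.
Qed.

Theorem theorem1 (i : nat) (alpha beta eps : C) :
  let I := RtoC (INR i) in
  let half := RtoC (/ 2) in
  (* first identity *)
  (nonpos_int_free [beta; 1 - alpha - eps + beta + I] ->
   kdf_abs_conv [alpha] [beta] [eps] [] [beta - eps; 1 - alpha - eps + I]
                [1 - alpha - eps + beta + I] half half ->
   gamma_finite (beta - eps - alpha + I + 1) ->
   gamma_finite (alpha - I) ->
   gamma_finite (1 - 2 * alpha - eps + beta + I) ->
   gamma_finite alpha ->
   (forall r : nat, (r <= i)%nat ->
      gamma_finite ((1 - 2 * alpha - eps + beta + I + RtoC (INR r)) / 2) /\
      gamma_finite ((beta - eps - I + RtoC (INR r) + 1) / 2)) ->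
   KdF [alpha] [beta] [eps] [] [beta - eps; 1 - alpha - eps + I]
       [1 - alpha - eps + beta + I] half half
   = Crpow 2 (I - alpha) * CGamma (beta - eps - alpha + I + 1) * CGamma (alpha - I)
       / (CGamma (1 - 2 * alpha - eps + beta + I) * CGamma alpha)
     * sum_n (fun r => Csign r * Cbinom i r
          * CGamma ((1 - 2 * alpha - eps + beta + I + RtoC (INR r)) / 2)
          / CGamma ((beta - eps - I + RtoC (INR r) + 1) / 2)) i)
  /\
  (* second identity *)
  (nonpos_int_free [beta; 1 - alpha - eps + beta - I] ->
   kdf_abs_conv [alpha] [beta] [eps] [] [beta - eps; 1 - alpha - eps - I]
                [1 - alpha - eps + beta - I] half half ->
   gamma_finite (beta - eps - alpha - I + 1) ->
   gamma_finite (1 - 2 * alpha - eps + beta - I) ->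
   (forall r : nat, (r <= i)%nat ->
      gamma_finite ((1 - 2 * alpha - eps + beta - I + RtoC (INR r)) / 2) /\
      gamma_finite ((beta - eps - I + RtoC (INR r) + 1) / 2)) ->
   KdF [alpha] [beta] [eps] [] [beta - eps; 1 - alpha - eps - I]
       [1 - alpha - eps + beta - I] half half
   = Crpow 2 (- alpha - I) * CGamma (beta - eps - alpha - I + 1)
       / CGamma (1 - 2 * alpha - eps + beta - I)
     * sum_n (fun r => Cbinom i r
          * CGamma ((1 - 2 * alpha - eps + beta - I + RtoC (INR r)) / 2)
          / CGamma ((beta - eps - I + RtoC (INR r) + 1) / 2)) i).
Proof.
  intros I half; unfold half; split.
  - replace (1 - alpha - eps + beta + I) with (1 - alpha - eps + I + beta) by ring.
    set (d := 1 - alpha - eps + I + beta).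
    replace (beta - eps - alpha + I + 1) with d by (unfold d; ring).
    replace (1 - 2 * alpha - eps + beta + I) with (d - alpha) by (unfold d; ring).
    assert (Hden : forall r, beta - eps - I + #r + 1 = d + alpha - 2 * I + #r)
      by (intros; unfold d; ring).
    intros Hfree Habs Hd Hai Hda Ha Hr.
    erewrite (sum_n_ext _ _ i) by (intros r; rewrite Hden; reflexivity).
    etransitivity; [exact (KdF_eq_rhyp _ _ _ _ _ Cmod_half_lt_1 Hfree Habs)|]; fold d.
    replace (1 - alpha - eps + I + eps) with (1 - alpha + I) by ring.
    unfold I in *; rewrite bailey_add_nat; trivial; [Cring|].
    intros r; rewrite <- Hden; apply Hr.
  - replace (1 - alpha - eps + beta - I) with (1 - alpha - eps - I + beta) by ring.
    set (d := 1 - alpha - eps - I + beta).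
    replace (beta - eps - alpha - I + 1) with d by (unfold d; ring).
    replace (1 - 2 * alpha - eps + beta - I) with (d - alpha) by (unfold d; ring).
    assert (Hden : forall r, beta - eps - I + #r + 1 = d + alpha + #r)
      by (intros; unfold d; ring).
    intros Hfree Habs Hd Hda Hr.
    erewrite (sum_n_ext _ _ i) by (intros r; rewrite Hden; reflexivity).
    etransitivity; [exact (KdF_eq_rhyp _ _ _ _ _ Cmod_half_lt_1 Hfree Habs)|]; fold d.
    replace (1 - alpha - eps - I + eps) with (1 - alpha - I) by ring.
    unfold I in *; rewrite bailey_sub_nat; trivial; [Cring|].
    intros r; rewrite <- Hden; apply Hr.
Qed.
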